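(* Let $R_\infty$ be the division ring constructed in the context, i.e. the division subring of $D=K((G,\Phi))$ generated over $F=\mathbb{Q}((H))$ by all $\sqrt{p_i}$, all $x_i$ ($i\ge1$), and the element $\alpha=x_1^{-1}+x_2^{-1}+\cdots$. Then $R_\infty$ is locally linear and it is not algebraic over its center.
   Context: Construction. Let $G=\bigoplus_{i=1}^\infty\mathbb{Z}$, the group of integer sequences $(n_1,n_2,\ldots)$ with finitely many nonzero terms, and let $x_i\in G$ be the sequence with $1$ in position $i$ and $0$ elsewhere; $G$ is free abelian on the $x_i$. The operation of $G$ is written multiplicatively. Order $G$ totally (lexicographically): $(n_1,n_2,\ldots)<(m_1,m_2,\ldots)$ if $n_1<m_1$ or there is $k\ge 1$ with $n_1=m_1,\ldots,n_k=m_k$ and $n_{k+1}<m_{k+1}$. Let $p_1<p_2<\cdots$ be an infinite sequence of prime numbers and $K=\mathbb{Q}(\sqrt{p_1},\sqrt{p_2},\ldots)\subseteq\mathbb{R}$. For each $i$ let $f_i\colon K\to K$ be the $\mathbb{Q}$-automorphism with $f_i(\sqrt{p_i})=-\sqrt{p_i}$ and $f_i(\sqrt{p_j})=\sqrt{p_j}$ for $j\ne i$; these commute. For $x=(n_1,n_2,\ldots)\in G$ put $\Phi_x=\prod_i f_i^{n_i}\in \mathrm{Gal}(K/\mathbb{Q})$; $x\mapsto\Phi_x$ is a group homomorphism $\Phi$. Let $D=K((G,\Phi))$ be the set of formal sums $\beta=\sum_{x\in G}a_x x$, $a_x\in K$, whose support $\mathrm{supp}(\beta)=\{x\in G: a_x\neq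 0\}$ is well-ordered, with operations $\sum a_x x+\sum b_x x=\sum (a_x+b_x)x$ and $(\sum a_x x)(\sum b_y y)=\sum_{z\in G}\big(\sum_{xy=z}a_x\Phi_x(b_y)\big)z$. This is a division ring (known), containing $K$ and $G$ in the obvious way. Let $H=\{x^2:x\in G\}$ and let $F=\mathbb{Q}((H))$ be the set of formal sums $\sum_{x\in H}a_x x$ with $a_x\in\mathbb{Q}$ and well-ordered support; $F$ is the center of $D$ (known). Let $\alpha=x_1^{-1}+x_2^{-1}+\cdots$ (infinite formal sum); since $x_1^{-1}<x_2^{-1}<\cdots$, its support is well-ordered, so $\alpha\in D$. For $n\ge1$ let $R_n=F(\sqrt{p_1},\ldots,\sqrt{p_n},x_1,\ldots,x_n,\alpha)$ be the division subring of $D$ generated over $F$ by the listed elements, and $R_\infty=\bigcup_{n\ge1}R_n$. Definitions. A division ring is centrally finite if it is a finite dimensional vector space over its center. A division ring is linear if it can be embedded in some centrally finite division ring. A division ring $E$ is locally linear if for every finite subset $S\subseteq E$ the division subring of $E$ generated by $S$ is linear. $E$ is algebraic over its center if every element of $E$ is algebraic over the center. *)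

(* Defs.v *)
From HB Require Import structures.
From mathcomp Require Import all_boot all_order all_algebra.
From mathcomp Require Import finmap.
From mathcomp Require Import all_classical all_reals.
From mathcomp Require Import zify ring lra.

Set Implicit Arguments.
Unset Strict Implicit.
Unset Printing Implicit Defensive.

Import Order.TTheory GRing.Theory Num.Theory.

Local Open Scope classical_set_scope.
Local Open Scope ring_scope.

Definition division_ring (E : unitRingType) : Prop :=
  forall x : E, x != 0 -> x \is a GRing.unit.

Definition subdiv (U : unitRingType) (S : divringClosed U) : Type :=
  {x : U | x \in S}.
HB.instance Definition _ U S := SubType.copy (@subdiv U S) {x : U | x \in S}.
HB.instance Definition _ U S := [Choice of @subdiv U S by <:].
HB.instance Definition _ U S :=
  [SubChoice_isSubUnitRing of @subdiv U S by <:].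

(* The division subring generated by A, as an intersection. In MathComp x^-1 = x
   for a non-unit x, so closure under x / y is the usual closure condition when
   U is a division ring. *)
Definition divgen (U : unitRingType) (A : set U) : {pred U} :=
  [pred x | `[< forall S : {pred U},
     GRing.divring_closed S -> A `<=` [set` S] -> x \in S >]].

Lemma divgen_closed (U : unitRingType) (A : set U) :
  GRing.divring_closed (divgen A).
Proof.
split=> [|x y /asboolP Sx /asboolP Sy|x y /asboolP Sx /asboolP Sy];
  apply/asboolP => S clS AS; have [S1 SB Sdiv] := clS => //.
- by apply: SB; [apply: Sx | apply: Sy].
- by apply: Sdiv; [apply: Sx | apply: Sy].
Qed.
HB.instance Definition _ (U : unitRingType) (A : set U) :=
  GRing.isDivringClosed.Build U (divgen A) (divgen_closed A).

Definition central (E : unitRingType) : {pred E} :=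
  [pred x | `[< forall y : E, GRing.comm x y >]].

Lemma central_closed (E : unitRingType) : GRing.divring_closed (@central E).
Proof.
split=> [|x y /asboolP cx /asboolP cy|x y /asboolP cx /asboolP cy];
  apply/asboolP => z; apply: commr_sym.
- exact: commr1.
- by apply: commrB; apply: commr_sym.
- by apply: commrM; [|apply: commrV]; apply: commr_sym.
Qed.
HB.instance Definition _ (E : unitRingType) :=
  GRing.isDivringClosed.Build E (@central E) (@central_closed E).

Definition center (E : unitRingType) := subdiv (@central E).
HB.instance Definition _ (E : unitRingType) := GRing.UnitRing.on (center E).

(* E as a left vector space over its center. *)
Definition over_center (E : unitRingType) : Type := E.
HB.instance Definition _ (E : unitRingType) :=
  GRing.Zmodule.on (over_center E).

Section OverCenter.
Variable E : unitRingType.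
Let scale (a : center E) (v : over_center E) : over_center E := (val a : E) * v.
Fact over_centerA a b v : scale a (scale b v) = scale (a * b) v.
Proof. by rewrite /scale mulrA. Qed.
Fact over_center1 : left_id 1 scale.
Proof. by move=> v; rewrite /scale mul1r. Qed.
Fact over_centerDr : right_distributive scale +%R.
Proof. by move=> a u v; rewrite /scale mulrDr. Qed.
Fact over_centerDl v : {morph scale^~ v : a b / a + b}.
Proof. by move=> a b; rewrite /scale mulrDl. Qed.
HB.instance Definition _ := GRing.Zmodule_isLmodule.Build (center E)
  (over_center E) over_centerA over_center1 over_centerDr over_centerDl.
End OverCenter.

Definition centrally_finite (E : unitRingType) : Prop :=
  exists (n : nat) (f : {linear over_center E -> 'rV[center E]_n}), bijective f.

Definition linear_division_ring (E : unitRingType) : Prop :=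
  exists L : unitRingType, [/\ division_ring L, centrally_finite L
    & exists f : {rmorphism E -> L}, injective f].

Definition locally_linear (E : unitRingType) : Prop :=
  forall S : set E, finite_set S -> linear_division_ring (subdiv (divgen S)).

Definition algebraic_over_center (E : unitRingType) : Prop :=
  forall x : E, exists2 q : {poly center E},
    q != 0 & root (map_poly (val : center E -> E) q) x.

(* The index group: integer sequences with finitely many nonzero terms, written
   additively and indexed from 0, ordered lexicographically. *)
Definition finite_seq : {pred nat -> int} :=
  [pred n | `[< finite_set [set i | n i != 0] >]].

Lemma finite_seq_closed : zmod_closed finite_seq.
Proof.
split=> [|m n /asboolP fm /asboolP fn]; apply/asboolP.
  by rewrite (_ : [set _ | _] = set0)// -subset0 => i /eqP[].
apply: (@sub_finite_set _ _ ([set i | m i != 0] `|` [set i | n i != 0])).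
  move=> i /= mni; apply: contrapT => /not_orP[/negP/negPn/eqP m0 /negP/negPn/eqP n0].
  by move: mni; rewrite !fctE m0 n0 subrr eqxx.
by rewrite finite_setU.
Qed.
HB.instance Definition _ :=
  GRing.isZmodClosed.Build (nat -> int) finite_seq finite_seq_closed.

Definition zseq : Type := {n : nat -> int | n \in finite_seq}.
HB.instance Definition _ := SubType.copy zseq {n : nat -> int | n \in finite_seq}.
HB.instance Definition _ := [Choice of zseq by <:].
HB.instance Definition _ := [SubChoice_isSubZmodule of zseq by <:].

Definition zcoef (x : zseq) (i : nat) : int := (val x : nat -> int) i.

Lemma zseqP (x y : zseq) : (forall i, zcoef x i = zcoef y i) <-> x = y.
Proof. by split=> [xy|->//]; apply/val_inj/funext => i; apply: xy. Qed.

Lemma zcoef_finite (x : zseq) : finite_set [set i | zcoef x i != 0].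
Proof. by have /asboolP := valP x. Qed.

Lemma zcoef0 i : zcoef 0 i = 0. Proof. by []. Qed.
Lemma zcoefD x y i : zcoef (x + y) i = zcoef x i + zcoef y i.
Proof. by []. Qed.
Lemma zcoefN x i : zcoef (- x) i = - zcoef x i. Proof. by []. Qed.

Fact zgen_subproof (i : nat) :
  (fun j => (j == i)%:Z : int) \in finite_seq.
Proof.
apply/asboolP; apply: (@sub_finite_set _ _ [set i]) => // j /=.
by case: (eqVneq j i).
Qed.
Definition zgen (i : nat) : zseq := exist (fun n => n \in finite_seq) _ (zgen_subproof i).

Lemma zcoef_gen i j : zcoef (zgen i) j = (j == i)%:Z.
Proof. by []. Qed.

Section LexicographicOrder.

Definition zlt (x y : zseq) : bool :=
  `[< exists k, (forall i, (i < k)%N -> zcoef x i = zcoef y i) /\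
                zcoef x k < zcoef y k >].
Let zle (x y : zseq) : bool := (x == y) || zlt x y.

Fact zlt_irr : irreflexive zlt.
Proof. by move=> x; apply/negP => /asboolP[k [_]]; rewrite ltxx. Qed.

Fact zlt_trans : transitive zlt.
Proof.
move=> y x z /asboolP[k [xy xyk]] /asboolP[l [yz yzl]]; apply/asboolP.
have [kl|lk|kl] := ltngtP k l.
- exists k; split=> [i ik|]; first by rewrite xy// yz// (ltn_trans ik).
  by rewrite -(yz _ kl).
- exists l; split=> [i il|]; first by rewrite xy ?yz// (ltn_trans il).
  by rewrite (xy _ lk).
- by subst l; exists k; split=> [i ik|]; [rewrite xy ?yz | apply: lt_trans yzl].
Qed.

Fact zlt_total x y : x != y -> zlt x y || zlt y x.
Proof.
move=> xy; have /ex_minnP[k xyk kmin] : exists i, zcoef x i != zcoef y i.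
  by apply: contra_notP (elimN eqP xy) => /forallNP h; apply/zseqP => i;
    apply/eqP/negPn/negP/h.
have eqk i : (i < k)%N -> zcoef x i = zcoef y i.
  by move=> ik; apply/eqP; apply: contraTT ik => /kmin; rewrite -leqNgt.
by case/orP: (lt_total xyk) => lk; apply/orP; [left|right]; apply/asboolP;
  exists k; split=> // i /eqk.
Qed.

HB.instance Definition _ := @Order.LtOrder.Build Order.default_display zseq
  zle zlt (fun x y => if zlt x y then x else y)
  (fun x y => if zlt x y then y else x)
  (fun _ _ => erefl) (fun _ _ => erefl) (fun _ _ => erefl)
  zlt_irr zlt_trans zlt_total.

End LexicographicOrder.

Lemma zltP (x y : zseq) : reflect
  (exists k, (forall i, (i < k)%N -> zcoef x i = zcoef y i) /\
             zcoef x k < zcoef y k) (x < y)%O.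
Proof. exact: asboolP. Qed.

Lemma zlt_add2r (z x y : zseq) : (x + z < y + z)%O = (x < y)%O.
Proof.
have sub (u v w : zseq) : (u < v)%O -> (u + w < v + w)%O.
  move=> /zltP[k [uv uvk]]; apply/zltP; exists k.
  by split=> [i ik|]; rewrite !zcoefD ?ltrD2r// uv.
by apply/idP/idP => [xy|]; [rewrite -(addrK z x) -(addrK z y); exact: sub | exact: sub].
Qed.

Lemma zle_add2r (z x y : zseq) : (x + z <= y + z)%O = (x <= y)%O.
Proof. by rewrite !leNgt zlt_add2r. Qed.

Lemma zlt_opp (x y : zseq) : (- x < - y)%O = (y < x)%O.
Proof.
by rewrite -(zlt_add2r (x + y)) addKr [x + y]addrC addKr.
Qed.

Definition well_ordered (A : set zseq) : Prop :=
  forall B, B `<=` A -> B !=set0 ->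
    exists2 b, B b & forall c, B c -> (b <= c)%O.

Lemma well_ordered_sub A B : A `<=` B -> well_ordered B -> well_ordered A.
Proof. by move=> AB wB C CA; apply: wB; apply: subset_trans AB. Qed.

Lemma well_ordered_set1 x : well_ordered [set x].
Proof.
move=> B Bx [b Bb]; exists b => // c Bc.
by rewrite (Bx _ Bb) (Bx _ Bc).
Qed.

Lemma well_orderedU A B :
  well_ordered A -> well_ordered B -> well_ordered (A `|` B).
Proof.
move=> wA wB C CAB [x Cx].
have [/set0P/wA-/(_ (@subIsetr _ _ _))|/negPn/eqP CA0] := boolP (C `&` A != set0);
  have [/set0P/wB-/(_ (@subIsetr _ _ _))|/negPn/eqP CB0] := boolP (C `&` B != set0).
- move=> [b [Cb Bb] bmin] [a [Ca Aa] amin].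
  have [ab|/ltW ba] := leP a b; [exists a|exists b] => // c Cc;
    have [Ac|Bc] := CAB _ Cc.
  + exact: amin.
  + by apply: le_trans ab _; exact: bmin.
  + by apply: le_trans ba _; exact: amin.
  + exact: bmin.
- move=> [a [Ca Aa] amin]; exists a => // c Cc.
  have [Ac|Bc] := CAB _ Cc; first exact: amin.
  by have : (C `&` B) c by []; rewrite CB0.
- move=> [b [Cb Bb] bmin]; exists b => // c Cc.
  have [Ac|Bc] := CAB _ Cc; last exact: bmin.
  by have : (C `&` A) c by []; rewrite CA0.
- have [Ax|Bx] := CAB _ Cx.
    by have : (C `&` A) x by []; rewrite CA0.
  by have : (C `&` B) x by []; rewrite CB0.
Qed.

Definition sumset (A B : set zseq) : set zseq :=
  [set z | exists x y, [/\ A x, B y & z = x + y]].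

Lemma well_ordered_sumset A B :
  well_ordered A -> well_ordered B -> well_ordered (sumset A B).
Proof.
move=> wA wB C CAB C0; apply: contrapT => noleast.
have nomin c : C c -> exists2 c', C c' & (c' < c)%O.
  move=> Cc; apply: contrapT => nc; apply: noleast; exists c => // d Cd.
  by rewrite leNgt; apply/negP => dc; apply: nc; exists d.
(* a is minimal among the left summands of the elements of C up to a + b *)
pose good a b := [/\ A a, B b, C (a + b) & forall a' b', A a' -> B b' ->
  C (a' + b') -> (a' + b' <= a + b)%O -> (a <= a')%O].
have goodE (D : set zseq) : D `<=` C -> D !=set0 ->
    (forall c d, D d -> C c -> (c <= d)%O -> D c) ->
  exists a b, good a b /\ D (a + b).
  move=> DC [d Dd] Dinit.
  pose L := [set a | A a /\ exists2 b, B b & D (a + b)].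
  have [a [Aa [b Bb Dab]] amin] : exists2 a, L a & forall c, L c -> (a <= c)%O.
    apply: wA => [a []//|].
    have [x [y [Ax By dE]]] := CAB _ (DC _ Dd).
    by exists x; split=> //; exists y => //; rewrite -dE.
  exists a, b; split=> //; split=> //; first exact: DC.
  move=> a' b' Aa' Bb' Cab' le; apply: amin; split=> //; exists b' => //.
  exact: Dinit le.
pose T := [set b | exists a, good a b].
have [b [a gab] bmin] : exists2 b, T b & forall c, T c -> (b <= c)%O.
  apply: wB => [b [a []]//|].
  have [a [b [gab _]]] := goodE C (fun=> id) C0 (fun _ _ _ Cc _ => Cc).
  by exists b, a.
have [Aa Bb Cab amin] := gab.
have [||c d [Cd dlt] Cc cd|a' [b' [gab' [Cab' lt]]]] :=
    goodE [set c | C c /\ (c < a + b)%O].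
- by move=> c [].
- by have [c Cc clt] := nomin _ Cab; exists c.
- by split=> //; apply: le_lt_trans dlt.
have bb' : (b <= b')%O by apply: bmin; exists a'.
have aa' : (a <= a')%O.
  by have [Aa' Bb' _ _] := gab'; apply: amin (ltW lt).
move: lt; rewrite ltNge => /negP; apply.
apply: (@le_trans _ _ (a' + b)); first by rewrite zle_add2r.
by rewrite ![a' + _]addrC zle_add2r.
Qed.

(* A well-ordered set that is also well-ordered after reversal is finite. *)
Lemma well_ordered_finite A : well_ordered A ->
  well_ordered [set x | A (- x)] -> finite_set A.
Proof.
move=> wA wN; apply: contrapT => infA.
pose below a := A `&` [set x | (x <= a)%O].
have [/wA-/(_ (fun _ => @proj1 _ _))|] :=
  pselect ([set a | A a /\ infinite_set (below a)] !=set0).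
  move=> [a [Aa inf] amin].
  have : [set x | A (- x) /\ (- x < a)%O] !=set0.
    apply: contrapT => /forallNP no; apply: inf.
    apply: (@sub_finite_set _ _ [set a]) => // x [Ax xa].
    apply/eqP; rewrite eq_le [(x <= a)%O]xa/= leNgt; apply/negP => lt.
    by apply: (no (- x)); rewrite /= opprK.
  move=> /wN-/(_ (fun _ => @proj1 _ _))[b [Ab ba] bmin].
  apply: inf; apply: (@sub_finite_set _ _ (a |` below (- b))).
    move=> x [Ax /= ]; rewrite le_eqVlt => /orP[/eqP->|xa]; [by left|right].
    split=> //=; rewrite -[x]opprK leNgt zlt_opp -leNgt.
    by apply: bmin; rewrite /= opprK.
  rewrite finite_setU; split=> //; apply: contrapT => infb.
  by have := amin (- b) (conj Ab infb); rewrite leNgt ba.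
move=> /forallNP allfin; apply: infA.
have [->//|/set0P [x Ax]] := eqVneq A set0.
have [|b Ab bmin] := wN _ (fun _ => id) _; first by exists (- x); rewrite /= opprK.
apply: contrapT => infA; apply: (allfin (- b)); split=> // fin; apply: infA.
apply: sub_finite_set fin => y Ay; split=> //=.
by rewrite -[y]opprK leNgt zlt_opp -leNgt; apply: bmin; rewrite /= opprK.
Qed.

(* A homomorphism from zseq to the automorphism group of a ring K. *)
Record zaction (K : nzRingType) := ZAction {
  zact :> zseq -> {rmorphism K -> K};
  zact0 : forall a, zact 0 a = a;
  zactD : forall x y a, zact (x + y) a = zact x (zact y a)
}.

Section Series.
Variables (K : nzRingType) (Phi : zaction K).

Definition wo_support : {pred zseq -> K} :=
  [pred a | `[< well_ordered [set x | a x != 0] >]].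

Lemma wo_support_closed : zmod_closed wo_support.
Proof.
split=> [|a b /asboolP wa /asboolP wb]; apply/asboolP.
  by move=> B B0 [x /B0/eqP[]].
apply: well_ordered_sub (well_orderedU wa wb) => x /= abx.
apply: contrapT => /not_orP[/negP/negPn/eqP a0 /negP/negPn/eqP b0].
by move: abx; rewrite !fctE a0 b0 subrr eqxx.
Qed.
HB.instance Definition _ :=
  GRing.isZmodClosed.Build (zseq -> K) wo_support wo_support_closed.

(* K((G, Phi)); Phi is a parameter of the type because the product uses it. *)
Definition series of zaction K : Type := {a : zseq -> K | a \in wo_support}.
Local Notation D := (series Phi).
HB.instance Definition _ := SubType.copy D {a : zseq -> K | a \in wo_support}.
HB.instance Definition _ := [Choice of D by <:].
HB.instance Definition _ := [SubChoice_isSubZmodule of D by <:].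

Definition mkseries (a : zseq -> K) (wa : a \in wo_support) : D :=
  exist (fun a => a \in wo_support) a wa.

Definition scoef (a : D) (x : zseq) : K := (val a : zseq -> K) x.

Definition supp (a : D) : set zseq := [set x | scoef a x != 0].

Lemma seriesP (a b : D) : (forall x, scoef a x = scoef b x) <-> a = b.
Proof. by split=> [ab|->//]; apply/val_inj/funext => x; apply: ab. Qed.

Lemma scoefD a b x : scoef (a + b) x = scoef a x + scoef b x.
Proof. by []. Qed.

Lemma well_ordered_supp a : well_ordered (supp a).
Proof. by have /asboolP := valP a. Qed.
Arguments well_ordered_supp : clear implicits.

Definition smul_coef (a b : D) (z : zseq) : K :=
  \sum_(u \in [set u : zseq * zseq | u.1 + u.2 = z])
     scoef a u.1 * Phi u.1 (scoef b u.2).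

(* The sums defining the product are finite. *)
Lemma sumset_fiber_finite A B z : well_ordered A -> well_ordered B ->
  finite_set [set x | A x /\ B (z - x)].
Proof.
move=> wA wB; apply: well_ordered_finite.
  by apply: well_ordered_sub wA => x [].
move=> C CAB [c Cc].
have [||_ [x Cx <-] bmin] := wB ((+%R z) @` C).
- by move=> _ [x Cx <-]; have [_] := CAB _ Cx; rewrite opprK.
- by exists (z + c), c.
exists x => // y Cy; rewrite -(zle_add2r z) ![_ + z]addrC.
by apply: bmin; exists y.
Qed.

Lemma smul_coefE a b z (s : seq zseq) : uniq s ->
  (forall x, supp a x -> supp b (z - x) -> x \in s) ->
  smul_coef a b z = \sum_(x <- s) scoef a x * Phi x (scoef b (z - x)).
Proof.
move=> us sub; rewrite /smul_coef.
rewrite (reindex_fsbig (fun x => (x, z - x)) setT) /=.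
  rewrite [RHS]fsbig_seq//; apply/esym/fsbig_widen => // x [_ /= xs].
  apply: contrapT => /eqP nz; apply: xs; apply: sub; apply: contraNN nz => /eqP ->.
    by rewrite mul0r.
  by rewrite rmorph0 mulr0.
split=> [x _ /=|x y _ _ [] //|[x y] /= <-]; first by rewrite addrC subrK.
by exists x => //; rewrite [x + y]addrC addrK.
Qed.

Lemma smul_range A B z : well_ordered A -> well_ordered B ->
  exists2 s : seq zseq, uniq s & forall x, A x -> B (z - x) -> x \in s.
Proof.
move=> wA wB; have fin := sumset_fiber_finite z wA wB.
exists (fset_set [set x | A x /\ B (z - x)]) => [|x Ax Bx]; first exact: fset_uniq.
by rewrite in_fset_set// inE.
Qed.

Lemma smul_coef_sub a b z : smul_coef a b z != 0 ->
  sumset (supp a) (supp b) z.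
Proof.
move=> nz; apply: contrapT => no; move: nz.
rewrite (@smul_coefE _ _ _ [::]) ?big_nil ?eqxx// => x ax bx; exfalso.
by apply: no; exists x, (z - x); split=> //; rewrite addrC subrK.
Qed.

Fact smul_subproof a b : smul_coef a b \in wo_support.
Proof.
apply/asboolP; apply: well_ordered_sub (@smul_coef_sub a b) _.
by apply: well_ordered_sumset; apply: well_ordered_supp.
Qed.
Definition smul (a b : D) : D := mkseries (smul_subproof a b).

Fact monomial_subproof (c : K) (x : zseq) :
  (fun y => if y == x then c else 0) \in wo_support.
Proof.
apply/asboolP; apply: well_ordered_sub (@well_ordered_set1 x) => y /=.
by case: (eqVneq y x) => // _; rewrite eqxx.
Qed.
Definition monomial (c : K) (x : zseq) : D := mkseries (monomial_subproof c x).

Lemma scoef_monomial c x y : scoef (monomial c x) y = if y == x then c else 0.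
Proof. by []. Qed.

Lemma scoefM a b z : scoef (smul a b) z = smul_coef a b z.
Proof. by []. Qed.

Lemma suppM a b : supp (smul a b) `<=` sumset (supp a) (supp b).
Proof. exact: smul_coef_sub. Qed.

Fact smulA : associative smul.
Proof.
move=> a b c; apply/seriesP => z; rewrite !scoefM.
have [sU uU sUP] := smul_range z (well_ordered_supp a)
  (well_ordered_sumset (well_ordered_supp b) (well_ordered_supp c)).
have [sX uX sXP] := smul_range z
  (well_ordered_sumset (well_ordered_supp a) (well_ordered_supp b))
  (well_ordered_supp c).
rewrite (smul_coefE uU); last by move=> x ax /suppM; apply: sUP.
rewrite (smul_coefE uX); last by move=> x /suppM abx cx; apply: sXP.
transitivity (\sum_(u <- sU) \sum_(x <- sX) scoef a u *
    (Phi u (scoef b (x - u)) * Phi x (scoef c (z - x)))).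
  apply: eq_bigr => u _; have [->|au] := eqVneq (scoef a u) 0.
    by rewrite mul0r big1// => x _; rewrite mul0r.
  rewrite -mulr_sumr; congr (_ * _); rewrite scoefM.
  rewrite (@smul_coefE _ _ _ [seq x - u | x <- sX]); first last.
  - move=> v bv cv; apply/mapP; exists (u + v); last by rewrite addrC addKr.
    apply: sXP; first by exists u, v.
    by rewrite opprD addrA.
  - by rewrite map_inj_uniq//; apply: addIr.
  rewrite big_map rmorph_sum; apply: eq_bigr => x _.
  by rewrite rmorphM -zactD [u + _]addrC subrK opprB addrA subrK.
rewrite exchange_big; apply: eq_bigr => x _.
have [c0|cx] := eqVneq (scoef c (z - x)) 0.
  by rewrite c0 rmorph0 mulr0 big1// => u _; rewrite !mulr0.
rewrite scoefM (smul_coefE uU) ?mulr_suml.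
  by apply: eq_bigr => u _; rewrite mulrA.
move=> u au bu; apply: sUP => //; exists (x - u), (z - x); split=> //.
by rewrite [RHS]addrC addrA subrK.
Qed.

Fact smul1 : left_id (monomial 1 0) smul.
Proof.
move=> a; apply/seriesP => z; rewrite scoefM (@smul_coefE _ _ _ [:: 0])//.
  by rewrite big_seq1 scoef_monomial eqxx mul1r subr0 zact0.
by move=> x; rewrite /supp /= scoef_monomial inE; case: (eqVneq x 0) => //; rewrite eqxx.
Qed.

Fact smulr1 : right_id (monomial 1 0) smul.
Proof.
move=> a; apply/seriesP => z; rewrite scoefM (@smul_coefE _ _ _ [:: z])//.
  by rewrite big_seq1 scoef_monomial subrr eqxx rmorph1 mulr1.
move=> x _; rewrite /supp /= scoef_monomial inE subr_eq0 eq_sym.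
by case: (eqVneq x z) => //; rewrite eqxx.
Qed.


Fact smulDl : left_distributive smul +%R.
Proof.
move=> a b c; apply/seriesP => z; rewrite scoefD !scoefM.
have [s us sP] := smul_range z
  (well_orderedU (well_ordered_supp (a + b))
     (well_orderedU (well_ordered_supp a) (well_ordered_supp b)))
  (well_ordered_supp c).
rewrite !(smul_coefE us); try by move=> x sx cx; apply: sP => //; rewrite /setU/=; tauto.
by rewrite -big_split; apply: eq_bigr => x _; rewrite scoefD mulrDl.
Qed.

Fact smulDr : right_distributive smul +%R.
Proof.
move=> a b c; apply/seriesP => z; rewrite scoefD !scoefM.
have [s us sP] := smul_range z (well_ordered_supp a)
  (well_orderedU (well_ordered_supp (b + c))
     (well_orderedU (well_ordered_supp b) (well_ordered_supp c))).
rewrite !(smul_coefE us); try by move=> x sx cx; apply: sP => //; rewrite /setU/=; tauto.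
by rewrite -big_split; apply: eq_bigr => x _; rewrite scoefD rmorphD mulrDr.
Qed.

Fact sone_neq0 : monomial 1 0 != 0.
Proof.
apply/eqP => /seriesP/(_ 0); rewrite scoef_monomial eqxx => /eqP.
by rewrite oner_eq0.
Qed.

HB.instance Definition _ := GRing.Zmodule_isNzRing.Build D
  smulA smul1 smulr1 smulDl smulDr sone_neq0.

(* As for any ring in classical logic: units are the elements with a two-sided
   inverse, and x^-1 is x when x has none. *)
Let sunit : pred D := [pred a | `[< exists b, b * a = 1 /\ a * b = 1 >]].
Let sinv (a : D) : D :=
  if pselect (exists b, b * a = 1 /\ a * b = 1) is left e then sval (cid e) else a.
Fact smulVr : {in sunit, left_inverse 1 sinv *%R}.
Proof. by move=> a /asboolP e; rewrite /sinv; case: pselect => // ?; case: cid => ? []. Qed.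
Fact sdivrr : {in sunit, right_inverse 1 sinv *%R}.
Proof. by move=> a /asboolP e; rewrite /sinv; case: pselect => // ?; case: cid => ? []. Qed.
Fact sunitP a b : b * a = 1 /\ a * b = 1 -> sunit a.
Proof. by move=> ab; apply/asboolP; exists b. Qed.
Fact sinv_out : {in [predC sunit], sinv =1 id}.
Proof. by move=> a /asboolP e; rewrite /sinv; case: pselect. Qed.
HB.instance Definition _ := GRing.NzRing_hasMulInverse.Build D
  smulVr sdivrr sunitP sinv_out.

End Series.

HB.instance Definition _ (F : fieldType) (S : divringClosed F) :=
  [SubNzRing_isSubComNzRing of @subdiv F S by <:].
HB.instance Definition _ (F : fieldType) (S : divringClosed F) :=
  [SubComUnitRing_isSubIntegralDomain of @subdiv F S by <:].
HB.instance Definition _ (F : fieldType) (S : divringClosed F) :=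
  [SubIntegralDomain_isSubField of @subdiv F S by <:].


Section SquareRoots.
Variables (R : realType) (p : nat -> nat).
Hypothesis pprime : forall i, prime (p i).
Hypothesis pinj : injective p.
Local Notation sq i := (Num.sqrt (p i)%:R : R).
Local Notation Q s := (divgen [set sq i | i in [set` s]]).

Lemma divgenS (U : unitRingType) (A B : set U) :
  A `<=` B -> {subset divgen A <= divgen B}.
Proof.
by move=> AB a /asboolP aA; apply/asboolP => S clS BS; apply: aA (subset_trans AB _).
Qed.

Lemma sub_divgen (U : unitRingType) (A : set U) a : A a -> a \in divgen A.
Proof. by move=> Aa; apply/asboolP => S _; apply. Qed.

Lemma divgen_ind (U : unitRingType) (A : set U) (S : {pred U}) :
  GRing.divring_closed S -> A `<=` [set` S] -> {subset divgen A <= S}.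
Proof. by move=> clS AS a /asboolP; apply. Qed.

Lemma divgen_set0 (a : R) : a \in divgen set0 -> exists q : rat, a = ratr q.
Proof.
move=> a0; pose S : {pred R} := [pred y | `[< exists q : rat, y = ratr q >]].
suff: a \in S by move/asboolP.
apply: (@divgen_ind R _ S _ _ _ a0) => //; split.
- by apply/asboolP; exists 1; rewrite rmorph1.
- move=> _ _ /asboolP[x ->] /asboolP[y ->]; apply/asboolP.
  by exists (x - y); rewrite rmorphB.
- move=> _ _ /asboolP[x ->] /asboolP[y ->]; apply/asboolP.
  by exists (x / y); rewrite fmorph_div.
Qed.

Lemma divgen_quadratic (A : set R) (r : R) : r ^+ 2 \in divgen A ->
  r \notin divgen A -> forall y, y \in divgen (r |` A) ->
  exists a b, [/\ a \in divgen A, b \in divgen A & y = a + b * r].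
Proof.
move=> r2 rA y yA; pose S : {pred R} := [pred y | `[< exists a b,
  [/\ a \in divgen A, b \in divgen A & y = a + b * r] >]].
suff: y \in S by move/asboolP.
apply: (@divgen_ind R _ S _ _ _ yA); last first.
  move=> x [->|Ax]; apply/asboolP.
    by exists 0, 1; rewrite rpred0 rpred1 add0r mul1r.
  by exists x, 0; rewrite rpred0 sub_divgen// mul0r addr0.
split.
- by apply/asboolP; exists 1, 0; rewrite rpred0 rpred1 mul0r addr0.
- move=> _ _ /asboolP[a [b [aA bA ->]]] /asboolP[c [d [cA dA ->]]].
  apply/asboolP; exists (a - c), (b - d); rewrite !rpredB//; split=> //; ring.
- move=> _ _ /asboolP[a [b [aA bA ->]]] /asboolP[c [d [cA dA ->]]].
  have [->|nz] := eqVneq (c + d * r) 0.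
    by apply/asboolP; exists 0, 0; rewrite rpred0 invr0 mulr0 mul0r addr0.
  have nz' : c - d * r != 0.
    apply: contra rA; rewrite subr_eq0 => /eqP cE.
    have [d0|d0] := eqVneq d 0.
      by move: nz; rewrite cE d0 !mul0r addr0 eqxx.
    by rewrite -[r](mulKf d0) -cE rpredM// rpredV.
  have [w wE] : exists w, w = r ^+ 2 by exists (r ^+ 2).
  rewrite -wE in r2; apply/asboolP.
  exists ((a * c - b * d * w) / (c * c - d * d * w)),
    ((b * c - a * d) / (c * c - d * d * w)); split.
  + by rewrite rpred_div// rpredB// ?rpredM.
  + by rewrite rpred_div// rpredB// ?rpredM.
  + have -> : c * c - d * d * w = (c + d * r) * (c - d * r) by rewrite wE; ring.
    by rewrite wE; field; apply/andP.
Qed.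

Lemma prod_primes_gt0 (t : seq nat) : (0 < \prod_(j <- t) p j)%N.
Proof. by rewrite big_seq prodn_cond_gt0// => j _; exact: prime_gt0. Qed.

Lemma logn_prod_primes i (t : seq nat) :
  logn (p i) (\prod_(j <- t) p j) = count_mem i t.
Proof.
elim: t => [|j t IHt]; first by rewrite big_nil logn1.
rewrite big_cons lognM ?(prime_gt0 (pprime j)) ?prod_primes_gt0//.
by rewrite IHt logn_prime// (inj_eq pinj) /= eq_sym.
Qed.

Lemma sqrt_primes_irrational i (t : seq nat) : uniq (i :: t) ->
  forall q : rat, Num.sqrt (\prod_(j <- i :: t) p j)%N%:R <> ratr q :> R.
Proof.
move=> ut q E; set m := (\prod_(j <- i :: t) p j)%N in E.
have m0 : (0 < m)%N by apply: prod_primes_gt0.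
have mq : (m%:R : rat) = q ^+ 2.
  apply: (fmorph_inj (ratr : {rmorphism rat -> R})).
  by rewrite rmorphXn /= -E sqr_sqrtr ?ler0n// ratr_nat.
have : m%:Z * denq q ^+ 2 = numq q ^+ 2.
  apply: (@intr_inj rat); rewrite rmorphM !rmorphXn/= -pmulrn mq numqE.
  by rewrite exprMn.
move=> /(congr1 absz); rewrite abszM !abszX absz_nat.
move=> /(congr1 (logn (p i))).
rewrite lognM// ?expn_gt0 ?absz_gt0 ?denq_neq0// !lognX logn_prod_primes.
rewrite count_uniq_mem// mem_head; lia.
Qed.

Lemma sqrt_primes_indep (s : seq nat) i (t : seq nat) : uniq (i :: t) ->
  uniq s -> ~~ has (mem s) (i :: t) ->
  Num.sqrt (\prod_(j <- i :: t) p j)%N%:R \notin Q s.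
Proof.
elim: s i t => [|k s IHs] i t ut.
  move=> _ _; apply/negP => /(divgenS (B := set0))-/(_ _)/divgen_set0[].
    by move=> x [j].
  exact: sqrt_primes_irrational.
move=> /andP[ks us] dis; apply/negP => mQ.
have sqr_sq (n : nat) : Num.sqrt n%:R ^+ 2 = n%:R :> R by rewrite sqr_sqrtr ?ler0n.
have natQ n : (n%:R : R) \in Q s by rewrite rpred_nat.
have kQ : sq k \notin Q s.
  have := IHs k [::]; rewrite big_seq1; apply=> //=.
  by rewrite orbF.
have [dis_s ki] : ~~ has (mem s) (i :: t) /\ k \notin i :: t.
  split; [apply: contra dis => /hasP[x xt xs]|apply: contra dis => kt].
    by apply/hasP; exists x => //=; rewrite inE (xs : x \in s) orbT.
  by apply/hasP; exists k => //=; rewrite inE eqxx.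
have [||a [b [aQ bQ mE]]] := divgen_quadratic _ kQ (y := Num.sqrt (\prod_(j <- i :: t) p j)%N%:R).
- by rewrite sqr_sq.
- apply: divgenS mQ => _ [x /= + <-]; rewrite inE => /orP[/eqP->|xs]; [by left|].
  by right; exists x.
set m := (\prod_(j <- i :: t) p j)%N in mE.
have E : 2 * a * b * sq k = m%:R - a ^+ 2 - b ^+ 2 * (p k)%:R.
  by have := sqr_sq m; rewrite mE sqrrD exprMn sqr_sq => <-; ring.
have [b0|b0] := eqVneq b 0.
  by have /negP[] := IHs i t ut us dis_s; rewrite -/m mE b0 mul0r addr0.
have [a0|a0] := eqVneq a 0.
  have /negP[] : Num.sqrt (\prod_(j <- k :: i :: t) p j)%N%:R \notin Q s.
    by apply: IHs => //; [rewrite cons_uniq ki | apply/norP].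
  rewrite big_cons -/m.
  rewrite natrM sqrtrM ?ler0n// mE a0 add0r mulrCA -expr2 sqr_sq.
  by rewrite rpredM.
move: kQ => /negP; apply.
have c0 : 2 * a * b != 0 by rewrite !mulf_neq0 ?pnatr_eq0.
rewrite -[sq k](mulKf c0) E rpredM// ?rpredV ?rpredM ?rpred_nat//.
by rewrite !rpredB ?rpredM// ?expr2 ?rpredM.
Qed.

Lemma divgen_finite (U : unitRingType) (I : choiceType) (g : I -> U) (A : set I) a :
  a \in divgen (g @` A) -> exists2 s : seq I,
    [set` s] `<=` A & a \in divgen (g @` [set` s]).
Proof.
move=> aA; pose S : {pred U} := [pred a | `[< exists2 s : seq I,
    [set` s] `<=` A & a \in divgen (g @` [set` s]) >]].
suff: a \in S by move/asboolP.
have join x y : x \in S -> y \in S -> exists2 s : seq I,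
    [set` s] `<=` A & x \in divgen (g @` [set` s]) /\ y \in divgen (g @` [set` s]).
  move=> /asboolP[s sA xs] /asboolP[t tA yt]; exists (s ++ t).
    by move=> i /=; rewrite mem_cat => /orP[/sA|/tA].
  by split; [apply: divgenS xs|apply: divgenS yt]; apply: image_subset => i /= h;
    rewrite mem_cat h ?orbT.
apply: (divgen_ind _ _ aA); last first.
  move=> _ [i Ai <-]; apply/asboolP; exists [:: i].
    by move=> j /=; rewrite inE => /eqP->.
  by apply: sub_divgen; exists i; rewrite /= ?inE.
split=> [|x y xS yS|x y xS yS]; apply/asboolP.
- by exists [::]; rewrite ?rpred1.
- by have [s sA [xs ys]] := join _ _ xS yS; exists s; rewrite ?rpredB.
- by have [s sA [xs ys]] := join _ _ xS yS; exists s; rewrite ?rpred_div.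
Qed.

Lemma sqrt_prime_indep i :
  sq i \notin divgen [set sq j | j in [set j | j != i]].
Proof.
apply/negP => /divgen_finite[s si sQ].
have := @sqrt_primes_indep (undup s) i [::]; rewrite big_seq1.
have -> : sq i \in Q (undup s).
  by apply: divgenS sQ => _ [j js <-]; exists j; rewrite /= ?mem_undup.
rewrite undup_uniq /= orbF mem_undup.
by case: (boolP (i \in s)) => [/si/=|_]; [rewrite eqxx|move=> /(_ isT isT isT)].
Qed.

End SquareRoots.

Section Construction.
Variables (R : realType) (p : nat -> nat).

Definition sqrt_field : Type :=
  subdiv (divgen (range (fun i => Num.sqrt (p i)%:R : R))).
HB.instance Definition _ := GRing.Field.on sqrt_field.
Local Notation K := sqrt_field.
Fact sqrtp_subproof i :
  Num.sqrt (p i)%:R \in divgen (range (fun i => Num.sqrt (p i)%:R : R)).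
Proof. by apply/asboolP => S _; apply; exists i. Qed.
Definition sqrtp (i : nat) : K :=
  exist (fun y : R => y \in divgen _) _ (sqrtp_subproof i).

Lemma val_sqrtp i : \val (sqrtp i) = Num.sqrt (p i)%:R :> R.
Proof. by []. Qed.

Lemma sqrt_field_rmorphism_ext (f g : {rmorphism K -> K}) :
  (forall i, f (sqrtp i) = g (sqrtp i)) -> f =1 g.
Proof.
move=> fg k; pose S : {pred R} :=
  [pred y | `[< exists k : K, \val k = y /\ f k = g k >]].
have /asboolP/(_ S) kS := valP k.
suff /asboolP[l [/val_inj <- //]] : \val k \in S.
apply: kS.
- split.
  + by apply/asboolP; exists 1; rewrite !rmorph1.
  + move=> _ _ /asboolP[x [<- fx]] /asboolP[y [<- fy]]; apply/asboolP.
    by exists (x - y); rewrite !rmorphB fx fy.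
  + move=> _ _ /asboolP[x [<- fx]] /asboolP[y [<- fy]]; apply/asboolP.
    by exists (x / y); rewrite !fmorph_div fx fy.
- by move=> _ [i _ <-]; apply/asboolP; exists (sqrtp i).
Qed.

Definition conj_spec (i : nat) (f : {rmorphism K -> K}) : Prop :=
  forall j, f (sqrtp j) = if j == i then - sqrtp j else sqrtp j.

(* The automorphism f_i, which sqrt_field_rmorphism_ext shows to be unique. The
   default value idfun is not used when the p i are distinct primes: see
   conj_autoE. *)
Definition conj_auto (i : nat) : {rmorphism K -> K} :=
  if pselect (exists f, conj_spec i f) is left e then sval (cid e) else idfun.

Lemma conj_autoE : (forall i, prime (p i)) -> injective p ->
  forall i, conj_spec i (conj_auto i).
Proof.
move=> pprime pinj i; rewrite /conj_auto; case: pselect => [e|[]]; first by case: cid.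
set r : R := Num.sqrt (p i)%:R.
pose A := [set (Num.sqrt (p j)%:R : R) | j in [set j | j != i]].
have rA : r \notin divgen A := sqrt_prime_indep R pprime pinj i.
have r2 : r ^+ 2 = (p i)%:R by rewrite sqr_sqrtr ?ler0n.
have AK : {subset divgen A <= divgen (range (fun i => Num.sqrt (p i)%:R : R))}.
  by apply: divgenS => _ [j _ <-]; exists j.
have dec (k : K) : exists y : K, exists a b, [/\ a \in divgen A, b \in divgen A,
    \val k = a + b * r & \val y = a - b * r :> R].
  have [||a [b [aA bA kE]]] := divgen_quadratic _ rA (y := \val k).
  - by rewrite r2 rpred_nat.
  - apply: divgenS (valP k) => _ [j _ <-]; have [->|ji] := eqVneq j i; [by left|].
    by right; exists j.
  have yK : a - b * r \in divgen (range (fun i => Num.sqrt (p i)%:R : R)).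
    by apply: rpredB; [exact: AK | apply: rpredM; [exact: AK | exact: sqrtp_subproof]].
  by exists (exist (fun y : R => y \in divgen _) _ yK), a, b.
pose g k := sval (cid (dec k)).
have gE (k : K) a b : a \in divgen A -> b \in divgen A -> \val k = a + b * r ->
    \val (g k) = a - b * r.
  move=> aA bA kE; rewrite /g; case: cid => y /= [c [d [cA dA kE' ->]]].
  have E : (b - d) * r = c - a by move: kE'; rewrite kE => kE'; lra.
  have [bd|bd] := eqVneq (b - d) 0.
    by move: E; rewrite bd mul0r (subr0_eq bd) => /esym/subr0_eq ->.
  by move: rA; rewrite -[r](mulKf bd) E rpredM ?rpredV ?rpredB.
have gz : zmod_morphism g.
  move=> x y; have [_ [a [b [aA bA xE _]]]] := dec x.
  have [_ [c [d [cA dA yE _]]]] := dec y.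
  apply: val_inj; rewrite (rmorphB \val) /= (gE x a b)// (gE y c d)//.
  rewrite (gE _ (a - c) (b - d)) ?rpredB//; first ring.
  by rewrite (rmorphB \val) /= xE yE; ring.
have gm : monoid_morphism g.
  split; first by apply: val_inj; rewrite (gE _ 1 0) ?rpred1 ?rpred0// mul0r ?addr0 ?subr0.
  move=> x y; have [_ [a [b [aA bA xE _]]]] := dec x.
  have [_ [c [d [cA dA yE _]]]] := dec y.
  apply: val_inj; rewrite (rmorphM \val) /= (gE x a b)// (gE y c d)//.
  rewrite (gE _ (a * c + b * d * (p i)%:R) (a * d + b * c)) -?r2; first ring.
  - by rewrite r2 rpredD ?rpredM ?rpred_nat.
  - by rewrite rpredD ?rpredM.
  - by rewrite (rmorphM \val) /= xE yE; ring.
pose gZ := GRing.isZmodMorphism.Build K K g gz.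
pose gM := GRing.isMonoidMorphism.Build K K g gm.
pose f : {rmorphism K -> K} := HB.pack g gZ gM.
exists f => j; apply: val_inj; have [->|ji] := eqVneq j i.
  by rewrite (rmorphN \val) /= (gE _ 0 1) ?rpred0 ?rpred1// ?add0r ?sub0r mul1r.
by rewrite /= (gE _ (Num.sqrt (p j)%:R) 0) ?rpred0// ?mul0r ?addr0 ?subr0//;
  apply: sub_divgen; exists j.
Qed.

Lemma conj_auto_sqrtp i : exists b : bool, forall j,
  conj_auto i (sqrtp j) = (-1) ^+ (b && (j == i)) * sqrtp j.
Proof.
rewrite /conj_auto; case: pselect => [e|_]; last first.
  by exists false => j; rewrite expr0 mul1r.
exists true => j /=; case: cid => f /= ->.
by case: eqP; rewrite ?expr1 ?mulN1r// expr0 mul1r.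
Qed.

Lemma conj_autoK i : involutive (conj_auto i).
Proof.
pose ff : {rmorphism K -> K} := conj_auto i \o conj_auto i.
apply: (@sqrt_field_rmorphism_ext ff idfun) => j /=.
have [b bE] := conj_auto_sqrtp i.
by rewrite bE rmorphM rmorphXn rmorphN1 bE signrMK.
Qed.

(* The composite of the f_i^{n_i} over the finitely many i such that n_i <> 0.
   Since f_i is an involution, f_i^n = f_i^|n| for every integer n. *)
Definition Phi_fun (x : zseq) : K -> K :=
  \big[comp/idfun]_(i <- fset_set [set i | zcoef x i != 0])
    iter `|zcoef x i| (conj_auto i).

Fact Phi_fun_rmorphism x : exists f : {rmorphism K -> K}, Phi_fun x = f.
Proof.
rewrite /Phi_fun.
apply: (big_ind (fun g : K -> K => exists f : {rmorphism K -> K}, g = f)).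
- by exists idfun.
- by move=> _ _ [f ->] [g ->]; exists (f \o g).
move=> i _;  elim: `|_|%N => [|n [f fE]]; first by exists idfun.
exists (conj_auto i \o f); apply/funext => a /=.
by rewrite -[X in _ = conj_auto i X]/((f : K -> K) a) -fE.
Qed.

Fact Phi_fun_zmod x : zmod_morphism (Phi_fun x).
Proof. by have [f ->] := Phi_fun_rmorphism x; apply: raddfB. Qed.
Fact Phi_fun_monoid x : monoid_morphism (Phi_fun x).
Proof.
by have [f ->] := Phi_fun_rmorphism x; split; [exact: rmorph1|exact: rmorphM].
Qed.
HB.instance Definition _ x :=
  GRing.isZmodMorphism.Build K K (Phi_fun x) (Phi_fun_zmod x).
HB.instance Definition _ x :=
  GRing.isMonoidMorphism.Build K K (Phi_fun x) (Phi_fun_monoid x).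

Definition Phi_map (x : zseq) : {rmorphism K -> K} := Phi_fun x.

Lemma Phi_sqrtp x j :
  Phi_map x (sqrtp j) = iter `|zcoef x j| (conj_auto j) (sqrtp j).
Proof.
have itE i n : exists c, iter n (conj_auto i) (sqrtp j) = (-1) ^+ (c && (j == i)) * sqrtp j.
  have [b bE] := conj_auto_sqrtp i; elim: n => [|n [c cE]].
    by exists false; rewrite mul1r.
  exists (b (+) c); rewrite iterS cE rmorphM rmorphXn rmorphN1 bE mulrA -signr_addb.
  by case: b c (j == i) {bE cE} => [|] [|] [|].
have itj i n : j != i -> iter n (conj_auto i) (sqrtp j) = sqrtp j.
  by move=> /negPf ji; have [c ->] := itE i n; rewrite ji andbF mul1r.
have key (s : seq nat) : uniq s ->
    (\big[comp/idfun]_(i <- s) iter `|zcoef x i| (conj_auto i)) (sqrtp j) =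
    if j \in s then iter `|zcoef x j| (conj_auto j) (sqrtp j) else sqrtp j.
  elim: s => [|i s IHs] /=; first by rewrite big_nil.
  move=> /andP[nis us]; rewrite big_cons /= IHs// inE.
  have [->|ji] := eqVneq j i; first by rewrite (negPf nis).
  case: ifP => _; last exact: itj.
  have [c ->] := itE j `|zcoef x j|%N.
  elim: `|zcoef x i|%N => //= n ->.
  by rewrite rmorphM rmorphXn rmorphN1; have /= -> := itj i 1%N ji.
rewrite /Phi_map /= /Phi_fun key ?fset_uniq// in_fset_set; last first.
  exact: zcoef_finite.
have [z0|nz] := eqVneq (zcoef x j) 0; last by rewrite ifT// inE.
by rewrite ifF ?z0//; apply/negbTE; rewrite notin_setE /= z0 eqxx.
Qed.

Fact Phi0 a : Phi_map 0 a = a.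
Proof.
by apply: (@sqrt_field_rmorphism_ext (Phi_map 0) idfun) => j; rewrite Phi_sqrtp.
Qed.

Fact PhiD x y a : Phi_map (x + y) a = Phi_map x (Phi_map y a).
Proof.
apply: (@sqrt_field_rmorphism_ext (Phi_map (x + y)) (Phi_map x \o Phi_map y)).
move=> j /=; have [b bE] := conj_auto_sqrtp j.
have PE z : Phi_map z (sqrtp j) = (-1) ^+ (b && odd `|zcoef z j|) * sqrtp j.
  rewrite Phi_sqrtp; elim: `|_|%N => [|n IHn]; first by rewrite andbF mul1r.
  rewrite iterS IHn rmorphM rmorphXn rmorphN1 bE eqxx andbT mulrA -signr_addb.
  by rewrite oddS; case: (b) (odd n) => [|] [|].
rewrite !PE rmorphM rmorphXn rmorphN1 PE mulrA -signr_addb; congr (_ ^+ _ * _).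
suff -> : odd `|zcoef (x + y) j| = odd `|zcoef x j| (+) odd `|zcoef y j|.
  by case: (b) (odd _) (odd _) => [|] [|] [|].
rewrite zcoefD; move: (zcoef x j) (zcoef y j) => m n.
lia.
Qed.

Definition Phi : zaction K := ZAction Phi0 PhiD.

Local Notation D := (series Phi).

(* K and G inside D. *)
Definition constD (a : K) : D := monomial Phi a 0.
Definition groupD (x : zseq) : D := monomial Phi 1 x.

(* Q((H)), where H is the group of squares (doubles, in additive notation). *)
Definition baseF : set D :=
  [set b : D | (forall x, supp b x -> exists y : zseq, x = y *+ 2) /\
               (forall x, exists q : rat, scoef b x = ratr q)].

Fact alpha_subproof :
  (fun x : zseq => if `[< exists i, x = - zgen i >] then 1 else 0) \in
  @wo_support K.
Proof.
have zgen_lt i j : (j < i)%N -> (zgen i < zgen j)%O.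
  move=> ji; apply/zltP; exists j; split=> [k kj|].
    by rewrite !zcoef_gen !ltn_eqF// (ltn_trans kj).
  by rewrite !zcoef_gen eqxx ltn_eqF.
apply/asboolP => B BA [x Bx].
have BE y : B y -> exists i, y = - zgen i.
  by move=> /BA /=; case: asboolP => //; rewrite eqxx.
have [i xE] := BE _ Bx; rewrite xE in Bx.
have ex : exists i, `[< B (- zgen i) >] by exists i; apply/asboolP.
case: (ex_minnP ex) => n /asboolP Bn nmin.
exists (- zgen n) => // y By; have [j yE] := BE _ By; rewrite yE in By *.
rewrite leNgt zlt_opp; apply/negP => /= lt.
have nj : (n <= j)%N by apply: nmin; apply/asboolP.
move: lt; case: (ltngtP n j) nj => // [nj _|-> _]; last by rewrite ltxx.
by move=> /(lt_trans (zgen_lt _ _ nj)); rewrite ltxx.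
Qed.
Definition alpha : D := mkseries Phi alpha_subproof.

(* R_n; the generators are indexed from 0, so those of R_n are the first n. *)
Definition Rgens (n : nat) : set D :=
  baseF `|` [set constD (sqrtp i) | i in [set i | (i < n)%N]]
        `|` [set groupD (zgen i) | i in [set i | (i < n)%N]] `|` [set alpha].

Definition Rn (n : nat) : {pred D} := divgen (Rgens n).

Definition Rinf_pred : {pred D} :=
  [pred a | `[< exists2 n, (1 <= n)%N & a \in Rn n >]].

Lemma Rn_sub m n : (m <= n)%N -> {subset Rn m <= Rn n}.
Proof.
move=> mn a /asboolP am; apply/asboolP => S clS nS; apply: am => //.
apply: subset_trans nS => b [[[Fb|[i im <-]]|[i im <-]]|->]; last by right.
- by do 3 left.
- by do 2 left; right; exists i => //; apply: leq_trans mn.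
- by left; right; exists i => //; apply: leq_trans mn.
Qed.

Lemma Rinf_closed : GRing.divring_closed Rinf_pred.
Proof.
have join a b : a \in Rinf_pred -> b \in Rinf_pred ->
    exists2 n, (1 <= n)%N & a \in Rn n /\ b \in Rn n.
  move=> /asboolP[m m1 am] /asboolP[n n1 bn]; exists (maxn m n).
    by rewrite (leq_trans m1)// leq_maxl.
  by split; [apply: Rn_sub am; apply: leq_maxl|apply: Rn_sub bn; apply: leq_maxr].
split=> [|a b ia ib|a b ia ib]; apply/asboolP.
- by exists 1%N => //; apply: rpred1.
- by have [n n1 [an bn]] := join _ _ ia ib; exists n => //; apply: rpredB.
- by have [n n1 [an bn]] := join _ _ ia ib; exists n => //; apply: rpred_div.
Qed.
HB.instance Definition _ :=
  GRing.isDivringClosed.Build D Rinf_pred Rinf_closed.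

Definition Rinf : Type := subdiv Rinf_pred.
HB.instance Definition _ := GRing.UnitRing.on Rinf.

End Construction.

(* Main.v *)
(* D is a division ring: a right inverse is built by Zorn's lemma on approximate
   right inverses ordered by truncation.

   Local linearity. A finite subset of R_oo lies in some R_n, and R_n lies in the
   centralizer L in D of the x_i with i >= n. Let C be the centralizer in D of all
   the x_i and of the sqrt(p_j) with j < n. Series in C have coefficients fixed by
   all the f_i, so C is commutative. Since sqrt(p_j) and x_j anticommute and have
   central squares, splitting elements into invariant and anti-invariant parts
   under conjugation shows that the 4^n products of the sqrt(p_j) and x_j, j < n,
   generate L over C. They commute with C, so C is central in L and L is centrally
   finite.

   Non-algebraicity. Conjugation by sqrt(p_j) changes the sign of the term x_j^-1
   of alpha. This gives infinitely many conjugates of alpha, which commute pairwise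
   as their coefficients are rational. All of them would be roots of a polynomial
   over the center that vanishes at alpha. *)
Require Import Defs.
From HB Require Import structures.
From mathcomp Require Import all_boot all_order all_algebra.
From mathcomp Require Import all_classical all_reals.

Set Implicit Arguments.
Unset Strict Implicit.
Unset Printing Implicit Defensive.

Import Order.TTheory GRing.Theory Num.Theory.

Local Open Scope classical_set_scope.
Local Open Scope ring_scope.

(** * Products with monomials and truncation of series *)

Section SeriesProduct.
Variables (K : nzRingType) (Phi : zaction K).
Local Notation D := (series Phi).

Lemma scoefB (a b : D) x : scoef (a - b) x = scoef a x - scoef b x.
Proof. by []. Qed.

Lemma scoef_mul (a b : D) z : scoef (a * b) z = smul_coef a b z.
Proof. by []. Qed.

Lemma scoef1 x : scoef (1 : D) x = if x == 0 then 1 else 0.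
Proof. by []. Qed.

Lemma scoef_monomialM c x (b : D) z :
  scoef (monomial Phi c x * b) z = c * Phi x (scoef b (z - x)).
Proof.
rewrite scoef_mul (@smul_coefE _ _ _ _ _ [:: x])// ?big_seq1 ?scoef_monomial ?eqxx//.
by move=> y; rewrite /supp /= scoef_monomial inE; case: (eqVneq y x) => //; rewrite eqxx.
Qed.

Lemma scoef_mulmonomial c x (b : D) z :
  scoef (b * monomial Phi c x) z = scoef b (z - x) * Phi (z - x) c.
Proof.
rewrite scoef_mul (@smul_coefE _ _ _ _ _ [:: z - x])//.
  by rewrite big_seq1 scoef_monomial subKr eqxx.
move=> y _; rewrite /supp /= scoef_monomial inE.
case: (eqVneq (z - y) x) => [<-|_]; last by rewrite eqxx.
by rewrite subKr eqxx.
Qed.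

Lemma monomialM c x d y :
  monomial Phi c x * monomial Phi d y = monomial Phi (c * Phi x d) (x + y).
Proof.
apply/seriesP => z; rewrite scoef_monomialM !scoef_monomial subr_eq [y + x]addrC.
by case: ifP => // _; rewrite rmorph0 mulr0.
Qed.

(** A difference at [m + w] would come from [x + y = m + w] with [m <= x] and [y] in the support of
    [b - b']; this forces [y <= w], where that difference vanishes. *)
Lemma scoef_mul_trunc (a b b' : D) m w : (forall x, supp a x -> (m <= x)%O) ->
  (forall y, (y <= w)%O -> scoef b y = scoef b' y) ->
  scoef (a * b) (m + w) = scoef (a * b') (m + w).
Proof.
move=> am bb'; apply/eqP; rewrite -subr_eq0 -scoefB -mulrBr; apply/negPn/negP.
move=> /smul_coef_sub[x [y [ax dy mwE]]].
have yw : (w < y)%O.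
  rewrite ltNge; apply/negP => /bb' E; move: dy.
  by rewrite /supp /= scoefB E subrr eqxx.
have := am _ ax; rewrite -(zle_add2r y) -mwE ![m + _]addrC zle_add2r.
by rewrite leNgt yw.
Qed.

End SeriesProduct.

(** * Inverses of series *)

Section SeriesInverse.
Variables (K : nzRingType) (Phi : zaction K).
Hypothesis KV : forall c : K, c != 0 -> exists d, c * d = 1.
Local Notation D := (series Phi).

Lemma zactK x : cancel (Phi (- x)) (Phi x).
Proof. by move=> c; rewrite -zactD subrr zact0. Qed.

(* Approximate right inverses of a, ordered by truncation, have a maximal
   element by Zorn's lemma; the union of a chain is again well-ordered because
   truncations are initial segments. *)
Lemma series_right_inverse (a : D) : a != 0 -> exists b, a * b = 1.
Proof.
move=> a0.
have [m am mmin] : exists2 m, supp a m & forall x, supp a x -> (m <= x)%O.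
  apply: (@well_ordered_supp _ _ a _ (fun _ => id)).
  apply: contrapT => /forallNP no; move/eqP: a0; apply; apply/seriesP => x.
  by apply/eqP/negPn/negP/no.
(* As [m] is the least exponent of [a], the coefficient of [a * b] at [m + y] depends only on the
   coefficients of [b] up to [y]. *)
pose good (b : D) := forall x, supp b x -> forall y, (y <= x)%O ->
  scoef (a * b) (m + y) = scoef (1 : D) (m + y).
pose T := {b : D | good b}.
pose le (b c : D) := forall x, supp b x -> forall y, (y <= x)%O -> scoef c y = scoef b y.
have supp_le b c x : le b c -> supp b x -> supp c x.
  by move=> bc bx; rewrite /supp /= (bc x).
have [||||t tmax] := @Zorn T (fun b c => `[< le (sval b) (sval c) >]).
- by move=> t; apply/asboolP.
- move=> r s t /asboolP rs /asboolP st; apply/asboolP => x rx y yx.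
  by rewrite (st x)// ?(rs x)//; apply: supp_le rx.
- move=> s t /asboolP st /asboolP ts; apply: eq_sig_hprop => [b|]; first exact: Prop_irrelevance.
  apply/seriesP => x.
  have [sx|/negP/negPn/eqP sx] := pselect (supp (sval s) x); first by rewrite (st x).
  have [tx|/negP/negPn/eqP tx] := pselect (supp (sval t) x); first by rewrite (ts x).
  by rewrite sx tx.
- move=> A Atot.
  (* The union of the chain: any member with [x] in its support may be chosen, since comparable
     members agree there. *)
  pose f x : K := if pselect (exists2 c : T, A c & supp (sval c) x) is left e
    then scoef (sval (sval (cid2 e))) x else 0.
  have fE (c : T) x y : A c -> supp (sval c) x -> (y <= x)%O -> f y = scoef (sval c) y.
    move=> Ac cx yx; rewrite /f; case: pselect => [e|ne].
      case: cid2 => c' Ac' c'y /=.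
      have [/asboolP cc'|/asboolP c'c] := Atot _ _ Ac Ac'; first by rewrite (cc' x).
      by rewrite (c'c y).
    apply/esym/eqP/negPn/negP => cy; apply: ne; by exists c.
  have f0 x : f x != 0 -> exists2 c : T, A c & supp (sval c) x.
    by rewrite /f; case: pselect => // _; rewrite eqxx.
  have wf : f \in @wo_support K.
    apply/asboolP => B Bf [x Bx]; have [c Ac cx] := f0 _ (Bf _ Bx).
    have [||b [Bb bx] bmin] := @well_ordered_supp _ _ (sval c) (B `&` [set y | (y <= x)%O]).
    + by move=> y [By yx]; rewrite /supp /= -(fE c x)//; apply: Bf.
    + by exists x; split=> /=.
    + exists b => // y By; have [yx|xy] := leP y x; first exact: bmin.
      by apply: le_trans (ltW xy); apply: bx.
  pose u : D := mkseries Phi wf.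
  have uE (c : T) x y : A c -> supp (sval c) x -> (y <= x)%O -> scoef u y = scoef (sval c) y.
    exact: fE.
  have gu : good u.
    move=> x /f0[c Ac cx] y yx; rewrite -(svalP c x cx y yx).
    by apply: scoef_mul_trunc => // w wy; apply: (uE c x) => //; apply: le_trans yx.
  exists (exist _ u gu) => c Ac; apply/asboolP => x cx y yx /=.
  exact: (uE c x).
case: t tmax => b gb tmax; exists b; apply: contrapT => ab1.
have [z dz zmin] : exists2 z, supp (a * b - 1) z &
    forall x, supp (a * b - 1) x -> (z <= x)%O.
  apply: (@well_ordered_supp _ _ (a * b - 1) _ (fun _ => id)).
  apply: contrapT => /forallNP no; apply: ab1; apply/subr0_eq/seriesP => x.
  by apply/eqP/negPn/negP/no.
(* [z] is the first exponent where [a * b] differs from 1; a new term of [b] at [y] changes [a * b]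
   only from [z] on. *)
pose y := z - m; have yz : m + y = z by rewrite addrC subrK.
have yb x : supp b x -> (x < y)%O.
  move=> bx; rewrite ltNge; apply/negP => yx; move: dz.
  by rewrite /supp /= scoefB -yz (gb x)// subrr eqxx.
have by0 : scoef b y = 0.
  by apply/eqP/negPn/negP => /yb; rewrite ltxx.
have [d amd] := KV am.
(* Chosen so that the new term [c] at [y] corrects the coefficient of [a * b] at [z]. *)
pose c := Phi (- m) (d * (scoef (1 : D) z - scoef (a * b) z)).
have amc : scoef a m * Phi m c = scoef (1 : D) z - scoef (a * b) z.
  by rewrite zactK mulrA amd mul1r.
have c0 : c != 0.
  apply: contraNneq dz => c0; move: amc; rewrite c0 rmorph0 mulr0 /supp /= scoefB.
  by move/eqP; rewrite eq_sym subr_eq0 => /eqP ->; rewrite subrr.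
pose b' := b + monomial Phi c y.
have bE x : scoef b' x = scoef b x + (if x == y then c else 0) by [].
have gb' : good b'.
  have lowb' w : (w <= y)%O -> scoef (a * b') (m + w) = scoef (1 : D) (m + w).
    rewrite le_eqVlt => /orP[/eqP->|wy].
      rewrite yz mulrDr scoefD scoef_mulmonomial -[X in z - X]/(z - m).
      rewrite /y subKr amc.
      by rewrite addrC subrK.
    rewrite (scoef_mul_trunc (b' := b) mmin) => [|x xw].
      apply/eqP; rewrite -subr_eq0 -scoefB; apply/negPn/negP => /zmin.
      by rewrite leNgt -yz ![m + _]addrC zlt_add2r wy.
    by rewrite bE lt_eqF ?addr0//; apply: le_lt_trans wy.
  move=> x b'x w wx; apply: lowb'; apply: le_trans wx _.
  move: b'x; rewrite /supp /= bE; case: (eqVneq x y) => [->//|_].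
  by rewrite addr0 => /yb/ltW.
have bb' : exist _ b' gb' = exist _ b gb.
  apply: tmax; apply/asboolP => x bx w wx /=.
  by rewrite bE lt_eqF ?addr0//; apply: le_lt_trans wx (yb _ bx).
move: c0 => /eqP; apply; have : scoef b' y = scoef b y by case: bb' => ->.
by rewrite bE by0 eqxx add0r.
Qed.

(** If [a * b = 1] and [b * c = 1], then [a = c], so the right inverse [b] is two-sided. *)
Lemma series_division : division_ring D.
Proof.
move=> a a0; have [b ab] := series_right_inverse a0.
have b0 : b != 0 by apply: contra_eq_neq ab => ->; rewrite mulr0 eq_sym oner_eq0.
have [c bc] := series_right_inverse b0.
have ac : a = c by rewrite -[LHS]mulr1 -bc mulrA ab mul1r.
by apply/unitrP; exists b; rewrite {1}ac bc.
Qed.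

End SeriesInverse.

(** * Division subrings, centralizers and spanning families *)

Lemma subdiv_division (U : unitRingType) (S : divringClosed U) :
  division_ring U -> division_ring (subdiv S).
Proof. by move=> divU x x0; apply: (divU (val x)); rewrite (inj_eq val_inj x 0). Qed.

Lemma preim_val_closed (U : unitRingType) (S T : divringClosed U) :
  GRing.divring_closed [pred y : subdiv S | (val y : U) \in T].
Proof.
split=> [|y z yT zT|y z yT zT]; rewrite inE.
- exact: (rpred1 T).
- exact: (rpredB yT zT).
- exact: (rpred_div yT zT).
Qed.

(** An element of [subdiv (divgen A)] is an element of [U] wrapped twice. The elements of [subdiv S]
    with value in [T] form a division subring containing [A], so it can be rewrapped over [T]. *)
Lemma divgen_embedding (U : unitRingType) (S T : divringClosed U) (A : set (subdiv S)) :
  (forall x, A x -> (val x : U) \in T) ->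
  exists f : {rmorphism subdiv (divgen A) -> subdiv T}, injective f.
Proof.
move=> AT.
have inT (x : subdiv (divgen A)) : (val (val x : subdiv S) : U) \in T.
  exact: (divgen_ind (@preim_val_closed U S T) AT (valP x)).
pose f (x : subdiv (divgen A)) : subdiv T := Sub (val (val x : subdiv S)) (inT x).
have fB : zmod_morphism f.
  by move=> x y; apply: val_inj; apply: erefl.
have fM : monoid_morphism f.
  split=> [|x y]; apply: val_inj; apply: erefl.
pose F : {rmorphism subdiv (divgen A) -> subdiv T} := HB.pack f
  (GRing.isZmodMorphism.Build _ _ f fB) (GRing.isMonoidMorphism.Build _ _ f fM).
by exists F => x y /(congr1 val)/= xy; do 2 apply: val_inj.
Qed.

Definition centralizer (U : unitRingType) (T : set U) : {pred U} :=
  [pred x | `[< forall t, T t -> GRing.comm x t >]].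

Lemma centralizer_closed (U : unitRingType) (T : set U) :
  GRing.divring_closed (centralizer T).
Proof.
split=> [|x y /asboolP cx /asboolP cy|x y /asboolP cx /asboolP cy];
  apply/asboolP => t Tt; apply: commr_sym.
- exact: commr1.
- by apply: commrB; apply: commr_sym; [exact: cx | exact: cy].
- by apply: commrM; [|apply: commrV]; apply: commr_sym; [exact: cx | exact: cy].
Qed.
HB.instance Definition _ (U : unitRingType) (T : set U) :=
  GRing.isDivringClosed.Build U (centralizer T) (@centralizer_closed U T).

Section Centralizers.
Variable U : unitRingType.
Implicit Types (T : set U) (u v b c : U).

Lemma centralizerP T b :
  reflect (forall t, T t -> GRing.comm b t) (b \in centralizer T).
Proof. exact: asboolP. Qed.

Lemma centralizerS T T' : T `<=` T' -> {subset centralizer T' <= centralizer T}.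
Proof.
by move=> TT' b /centralizerP bT; apply/centralizerP => t /TT'; apply: bT.
Qed.

(* The conjugation by u is an involution because u ^+ 2 is central; b is the sum
   of an invariant and an anti-invariant element, and v ^-1 turns the latter
   into an invariant one, as v anticommutes with u. *)
Lemma centralizer_split T u v b :
  (2 : U) \is a GRing.unit -> u \is a GRing.unit -> v \is a GRing.unit ->
  (forall x, GRing.comm (u * u) x) -> v * u = - (u * v) ->
  (forall t, T t -> exists s : bool, t * u = (-1) ^+ s * (u * t)) ->
  v \in centralizer T -> b \in centralizer T ->
  exists c d, [/\ c \in centralizer (u |` T), d \in centralizer (u |` T)
                & b = c + d * v].
Proof.
move=> u2 uu uv uuC vu Tu vT bT.
pose s := u * b / u.
have us : u * s = b * u by rewrite /s !mulrA uuC -mulrA mulrK.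
have su : s * u = u * b by rewrite /s mulrVK.
(* Moving [t] past [u] and past its inverse gives the same sign twice, so conjugation by [u]
   preserves the centralizer. *)
have sT : s \in centralizer T.
  apply/centralizerP => t Tt; have [e tu] := Tu _ Tt.
  have eC x : GRing.comm ((-1) ^+ e) x by apply/commr_sym/commr_sign.
  apply: (mulIr uu); rewrite -[LHS]mulrA tu -[RHS]mulrA su [RHS]mulrA tu.
  rewrite [LHS]mulrA -eC -!mulrA; congr (_ * _).
  by rewrite mulKr// (centralizerP _ _ bT _ Tt).
clearbody s; have half : (2 : U)^-1 \in centralizer setT.
  by rewrite rpredV; apply/centralizerP => t _; apply: commr_sym; apply: commr_nat.
have halfC x : GRing.comm (2^-1 : U) x by apply: (centralizerP _ _ half).
exists (2^-1 * (b + s)), (2^-1 * (b - s) / v); split; last first.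
- rewrite mulrVK// -mulrDr addrACA subrr addr0 -mulr2n -(mulr_natl b) mulKr//.
- apply/centralizerP => t [->|Tt]; last first.
    have : 2^-1 * (b - s) / v \in centralizer T by rewrite !rpredM ?rpredV ?rpredB ?rpred_nat.
    by move/centralizerP; apply.
  have vVu : v^-1 * u = - (u / v).
    by apply: (mulrI uv); rewrite mulVKr// mulrN !mulrA vu mulNr opprK mulrK.
  rewrite /GRing.comm -[LHS]mulrA vVu mulrN [in LHS]mulrA -mulNr [RHS]mulrA; congr (_ / v).
  rewrite [RHS]mulrA -(halfC u) -!mulrA -mulrN; congr (_ * _).
  by rewrite mulrBl mulrBr us su opprB.
- apply/centralizerP => t [->|Tt]; last first.
    have : 2^-1 * (b + s) \in centralizer T by rewrite rpredM ?rpredV ?rpred_nat ?rpredD.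
    by move/centralizerP; apply.
  rewrite /GRing.comm mulrA -(halfC u) -!mulrA; congr (_ * _).
  by rewrite mulrDl mulrDr us su addrC.
Qed.

(** The family [e] commutes with all the coefficients, which makes them central once they also
    commute with one another. *)
Definition spanned_centralizer T T' : Prop :=
  exists (I : finType) (e : I -> U),
    [/\ forall i, e i \in centralizer T,
        forall i c, c \in centralizer T' -> GRing.comm (e i) c
      & forall b, b \in centralizer T -> exists2 c : I -> U,
          forall i, c i \in centralizer T' & b = \sum_i c i * e i].

Lemma spanned_centralizer_refl T : spanned_centralizer T T.
Proof.
exists unit, (fun=> 1); split=> [_|_ c _|b bT]; first exact: rpred1.
  exact/commr_sym/commr1.
by exists (fun=> b) => //; rewrite (big_pred1 tt) ?mulr1// => -[].
Qed.

(** Splitting [b = c + d * v] doubles the family to [e i] and [e i * v]; as [v] is in [T'], the new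
    elements still commute with the coefficients. *)
Lemma spanned_centralizer_step T T' u v :
  (2 : U) \is a GRing.unit -> u \is a GRing.unit -> v \is a GRing.unit ->
  (forall x, GRing.comm (u * u) x) -> v * u = - (u * v) ->
  (forall t, T t -> exists s : bool, t * u = (-1) ^+ s * (u * t)) ->
  v \in centralizer T -> T' v ->
  spanned_centralizer (u |` T) T' -> spanned_centralizer T T'.
Proof.
move=> u2 uu uv uuC vu Tu vT T'v [I [e [eT eC eP]]].
have sub : {subset centralizer (u |` T) <= centralizer T}.
  by apply: centralizerS => t; right.
exists (I + I)%type, (fun i => match i with inl i => e i | inr i => e i * v end).
split=> [[]i|[]i c cT'|b bT].
- exact/sub.
- by rewrite rpredM// sub.
- exact: eC.
- apply: commr_sym; apply: commrM; apply: commr_sym; first exact: eC.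
  by apply: commr_sym; apply: (centralizerP _ _ cT').
have [c [d [cT dT bE]]] := centralizer_split u2 uu uv uuC vu Tu vT bT.
have [x xT cE] := eP _ cT; have [y yT dE] := eP _ dT.
exists (fun i => match i with inl i => x i | inr i => y i end); first by case.
rewrite big_sumType /= bE cE dE mulr_suml; congr (_ + _).
by apply: eq_bigr => i _; rewrite mulrA.
Qed.

End Centralizers.

(** * Central finiteness, and an obstruction to algebraicity *)

Section CentrallyFinite.
Variable E : unitRingType.
Hypothesis divE : division_ring E.

Lemma center_valB (a b : center E) : (val (a - b) : E) = val a - val b.
Proof. by []. Qed.

Lemma center_valD (a b : center E) : (val (a + b) : E) = val a + val b.
Proof. by []. Qed.

Lemma center_valM (a b : center E) : (val (a * b) : E) = val a * val b.
Proof. by []. Qed.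

Definition spans_over_center n (e : 'I_n -> E) : Prop :=
  forall b, exists c : 'I_n -> center E, b = \sum_i (val (c i) : E) * e i.

(** A spanning family of least length is free, so its coordinates give the linear bijection. *)
Lemma spanning_centrally_finite n (e : 'I_n -> E) :
  spans_over_center e -> centrally_finite E.
Proof.
move=> span_e.
have ex : exists n, `[< exists e : 'I_n -> E, spans_over_center e >].
  by exists n; apply/asboolP; exists e.
case: (ex_minnP ex) => {span_e e}m /asboolP[e span_e] mmin {ex}.
have free (c : 'I_m -> center E) :
    \sum_i (val (c i) : E) * e i = 0 -> forall i, c i = 0.
  move=> c0 j; apply/eqP; apply: contrapT => /negP cj.
  have ucj : (val (c j) : E) \is a GRing.unit.
    by apply: divE; rewrite (inj_eq val_inj (c j) 0).
  case: m e span_e mmin c c0 j cj ucj => [|m] e span_e mmin c c0 j cj ucj.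
    by case: j cj ucj.
  suff /mmin : `[< exists e : 'I_m -> E, spans_over_center e >] by rewrite ltnn.
  apply/asboolP; exists (e \o lift j) => b; have [d ->] := span_e b.
  (* [e j] is eliminated by the relation [c0], in which its coefficient [c j] is invertible. *)
  exists (fun i => d (lift j i) - d j / c j * c (lift j i)).
  have ej : e j = - \sum_i (val (c j) : E)^-1 * ((val (c (lift j i)) : E) * e (lift j i)).
    apply: (mulrI ucj); rewrite mulrN mulr_sumr; apply/eqP.
    rewrite -addr_eq0 -[X in _ == X]c0 (bigD1_ord j)//=; apply/eqP; congr (_ + _).
    by apply: eq_bigr => i _; rewrite mulVKr.
  rewrite (bigD1_ord j)//= ej mulrN mulr_sumr -sumrN -big_split /=.
  apply: eq_bigr => i _.
  by rewrite mulrBl addrC !mulrA.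
pose f (b : over_center E) : 'rV[center E]_m := \row_i sval (cid (span_e b)) i.
have fE b : b = \sum_i (val (f b 0 i) : E) * e i.
  by rewrite [LHS](svalP (cid (span_e b))); apply: eq_bigr => i _; rewrite mxE.
(* Freeness makes coordinates unique, which yields both linearity and bijectivity of [f]. *)
have fU b (r : 'rV[center E]_m) : b = \sum_i (val (r 0 i) : E) * e i -> f b = r.
  move=> bE; apply/rowP => i; apply/eqP; rewrite -subr_eq0; apply/eqP.
  apply: (free (fun i => f b 0 i - r 0 i)).
  under eq_bigr do rewrite center_valB mulrBl.
  by rewrite sumrB -fE -bE subrr.
have flin : linear f.
  move=> a u v; apply: fU; rewrite [in LHS](fE u) [in LHS](fE v).
  rewrite /GRing.scale /= mulr_sumr -big_split; apply: eq_bigr => i _ /=.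
  by rewrite !mxE center_valD center_valM mulrDl mulrA.
pose fL := GRing.isLinear.Build _ _ _ _ f flin.
pose F : {linear over_center E -> 'rV[center E]_m} := HB.pack f fL.
exists m, F.
exists (fun r : 'rV[center E]_m => \sum_i (val (r 0 i) : E) * e i : over_center E).
  by move=> b; apply/esym/fE.
by move=> r; apply: fU.
Qed.

End CentrallyFinite.

(** The coefficients commute with each other and with every [e i], hence with all combinations, so
    they are central. *)
Lemma centralizer_centrally_finite (U : unitRingType) (T T' : set U) :
  division_ring U -> T `<=` T' ->
  {in centralizer T' &, forall x y, GRing.comm x y} ->
  spanned_centralizer T T' -> centrally_finite (subdiv (centralizer T)).
Proof.
move=> divU TT' T'C [I [e [eT eC eP]]]; pose E := subdiv (centralizer T).
pose e' (i : 'I_#|I|) : E := Sub (e (enum_val i)) (eT _).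
apply: (spanning_centrally_finite (subdiv_division divU) (e := e')).
move=> b; have [c cT' bE] := eP _ (valP b).
have cT i : c i \in centralizer T by apply: centralizerS (cT' i).
have cC i : (Sub (c i) (cT i) : E) \in @central E.
  apply/asboolP => x; apply: val_inj; rewrite !rmorphM /=.
  have [d dT' ->] := eP _ (valP x).
  apply: commr_sum => j _; apply: commrM; first exact: T'C.
  exact/commr_sym/eC.
exists (fun i => Sub (Sub (c (enum_val i)) (cT _) : E) (cC _)).
apply: val_inj; rewrite bE rmorph_sum (reindex _ (onW_bij _ (enum_val_bij I))).
by apply: eq_bigr => i _; rewrite rmorphM.
Qed.

(* All conjugates of a are roots of a polynomial over the center vanishing at a. *)
Lemma infinite_conjugates_not_algebraic (E : unitRingType) (a : E) (s : nat -> E) :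
  division_ring E -> (forall j, s j \is a GRing.unit) ->
  (forall i j, GRing.comm (s i * a / s i) (s j * a / s j)) ->
  injective (fun j => s j * a / s j) -> ~ algebraic_over_center E.
Proof.
move=> divE us wC winj /(_ a)[q q0]; set P := map_poly _ q => Pa.
pose w j := s j * a / s j.
have PE i : P`_i = val q`_i by rewrite coef_map_id0.
have P0 : P != 0.
  apply: contra q0 => /eqP P0; apply/eqP/polyP => i; apply: val_inj.
  by rewrite -PE P0 !coef0.
have wX j i : w j ^+ i = s j * a ^+ i / s j.
  elim: i => [|i IHi]; first by rewrite !expr0 mulr1 divrr.
  by rewrite !exprSr IHi /w !mulrA mulrVK.
(* The coefficients are central, so the value of [P] at [w j] is the conjugate by [s j] of its value
   at [a], which is 0. *)
have Pw j : root P (w j).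
  have -> : root P (w j) = (s j * P.[a] / s j == 0).
    rewrite /root !horner_coef mulr_sumr mulr_suml; congr (_ == 0).
    apply: eq_bigr => i _; rewrite wX !mulrA; congr (_ * _ / _).
    have /asboolP : (val q`_i : E) \in @central _ by apply: valP.
    by rewrite PE; apply.
  by move/eqP: Pa => ->; rewrite mulr0 mul0r.
(* The root bound over a noncommutative ring asks for roots that commute pairwise and have
   invertible differences. *)
have uw (l : seq nat) : uniq l -> uniq_roots (map w l).
  elim: l => //= i l IHl /andP[il /IHl ->]; rewrite andbT.
  rewrite all_map; apply/allP => j jl /=; apply/andP; split; first exact/eqP/wC.
  by apply: divE; rewrite subr_eq0; apply: contraNneq il => /winj <-.
have rootsP : all (root P) (map w (iota 0 (size P))).
  by rewrite all_map; apply/allP => j _; apply: Pw.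
have := max_ring_poly_roots P0 rootsP (uw _ (iota_uniq 0 (size P))).
by rewrite size_map size_iota ltnn.
Qed.

(** * Commutation in the series ring *)

Section SeriesCommutation.
Variables (K : nzRingType) (Phi : zaction K).
Local Notation D := (series Phi).

Definition fixed_coefs (a : D) : Prop := forall x y, Phi x (scoef a y) = scoef a y.

(** With no twist left, the product is a plain convolution, symmetric under [x -> z - x]. *)
Lemma fixed_coefs_comm (a b : D) : (forall c d : K, GRing.comm c d) -> fixed_coefs a -> fixed_coefs b -> GRing.comm a b.
Proof.
move=> KC fa fb; apply/seriesP => z; rewrite !scoef_mul.
have [s us sP] := smul_range z (@well_ordered_supp _ _ a) (@well_ordered_supp _ _ b).
rewrite (smul_coefE us)// (@smul_coefE _ _ _ _ _ [seq z - x | x <- s]).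
- by rewrite big_map; apply: eq_bigr => x _; rewrite subKr fa fb KC.
- by rewrite map_inj_uniq// => x y /(congr1 (fun t => z - t)); rewrite !subKr.
- by move=> x bx ax; apply/mapP; exists (z - x); rewrite ?subKr// sP ?subKr.
Qed.

Lemma monomial_neq0 c x : c != 0 -> monomial Phi c x != 0.
Proof.
move=> c0; apply: contra c0 => /eqP/seriesP/(_ x).
by rewrite scoef_monomial eqxx => ->.
Qed.

Lemma monomialN c x : monomial Phi (- c) x = - monomial Phi c x.
Proof.
apply/seriesP => y; rewrite -[RHS]/(- scoef (monomial Phi c x) y) !scoef_monomial.
by case: ifP; rewrite ?oppr0.
Qed.

Lemma comm_monomial1 x (b : D) :
  GRing.comm (monomial Phi 1 x) b <-> forall y, Phi x (scoef b y) = scoef b y.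
Proof.
split=> [/seriesP xb y|xb].
  have := xb (y + x).
  by rewrite scoef_monomialM scoef_mulmonomial mul1r addrK rmorph1 mulr1.
apply/seriesP => z.
by rewrite scoef_monomialM scoef_mulmonomial mul1r xb rmorph1 mulr1.
Qed.

Lemma fixed_comm_gen i (b : D) :
  (forall y, Phi (zgen i) (scoef b y) = scoef b y) ->
  GRing.comm b (monomial Phi 1 (zgen i)).
Proof. by move=> fb; apply/commr_sym/comm_monomial1. Qed.

Lemma comm_monomial0 c (b : D) :
  (forall d, GRing.comm c d) -> (forall x, Phi x c = c) ->
  GRing.comm (monomial Phi c 0) b.
Proof.
move=> cC fc; apply/seriesP => z.
by rewrite scoef_monomialM scoef_mulmonomial fc zact0 cC.
Qed.

End SeriesCommutation.

(** * Centralizers of the [x_i] and of the square roots *)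

(* s i plays the role of the square root of p i. *)
Section SignAction.
Variables (K : nzRingType) (Phi : zaction K) (s : nat -> K).
Hypothesis KC : forall c d : K, GRing.comm c d.
Hypothesis divD : division_ring (series Phi).
Hypothesis K2 : (2 : K) != 0.
Hypothesis s_neq0 : forall i, s i != 0.
Hypothesis sq_fixed : forall x i, Phi x (s i * s i) = s i * s i.
Hypothesis gen_s : forall i j, Phi (zgen i) (s j) = (-1) ^+ (i == j) * s j.
Hypothesis gen_involutive : forall i c, Phi (zgen i) (Phi (zgen i) c) = c.
Hypothesis gen_fixed : forall c, (forall i, Phi (zgen i) c = c) -> forall x, Phi x c = c.
Local Notation D := (series Phi).
Local Notation X i := (monomial Phi 1 (zgen i)).
Local Notation S i := (monomial Phi (s i) 0).

Lemma genM_sqrtp i j : X i * S j = (-1) ^+ (i == j) * (S j * X i).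
Proof.
rewrite !monomialM mul1r addr0 add0r rmorph1 mulr1 gen_s.
by case: (i == j); [rewrite !expr1 !mulN1r monomialN | rewrite !expr0 !mul1r].
Qed.

Lemma gen_comm i j : GRing.comm (X i) (X j).
Proof. by rewrite /GRing.comm !monomialM !rmorph1 addrC. Qed.

Lemma sqrtp_comm i j : GRing.comm (S i) (S j).
Proof. by rewrite /GRing.comm !monomialM !zact0 KC. Qed.

Lemma gen_sq_central i b : GRing.comm (X i * X i) b.
Proof.
rewrite monomialM rmorph1 mulr1; apply/comm_monomial1 => y.
by rewrite zactD gen_involutive.
Qed.

Lemma sqrtp_sq_central i b : GRing.comm (S i * S i) b.
Proof. by rewrite monomialM zact0 addr0; apply: comm_monomial0 => // x; apply: sq_fixed. Qed.

Lemma unit_gen i : X i \is a GRing.unit.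
Proof. by apply: divD; apply: monomial_neq0; apply: oner_neq0. Qed.

Lemma unit_sqrtp i : S i \is a GRing.unit.
Proof. by apply: divD; apply: monomial_neq0; apply: s_neq0. Qed.

Lemma unit2 : (2 : D) \is a GRing.unit.
Proof.
apply: divD; apply/eqP => /seriesP/(_ 0).
rewrite mulr2n scoefD scoef1 eqxx => /eqP; apply/negP.
exact: K2.
Qed.

(** Its centralizer is the centrally finite division ring into which [R_n] embeds. *)
Definition high_gens n : set D := [set X i | i in [set i | (n <= i)%N]].

(** Its centralizer is the commutative ring of coefficients. *)
Definition gens_sqrts n : set D :=
  range (fun i => X i) `|` [set S i | i in [set i | (i < n)%N]].

Lemma centralizer_gens_fixed n b : b \in centralizer (gens_sqrts n) -> fixed_coefs b.
Proof.
move=> /centralizerP bC x y; apply: gen_fixed => i; move: y; apply/comm_monomial1.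
by apply/commr_sym/bC; left; exists i.
Qed.

(** Starting from [k = n], the roots are dropped from the top with [u = S l] and [v = X l]: these
    anticommute, and [X l] commutes with the remaining [S i], [i < l]. *)
Lemma spanned_gens_sqrts n k : (k <= n)%N ->
  spanned_centralizer (gens_sqrts k) (gens_sqrts n).
Proof.
move=> kn; rewrite -(subKn kn); elim: (n - k)%N => [|m IHm].
  by rewrite subn0; apply: spanned_centralizer_refl.
(* For [n <= m] the truncated difference is already 0, and nothing more is dropped. *)
have [nm|mn] := leqP n m.
  have n0 : (n - m)%N = 0%N by apply/eqP; rewrite subn_eq0.
  by move: IHm; rewrite subnS n0.
set l := (n - m.+1)%N; have lE : (n - m)%N = l.+1 by rewrite /l subnSK.
have ln : (l < n)%N by rewrite -lE leq_subr.
rewrite lE in IHm.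
apply: (@spanned_centralizer_step _ _ _ (S l) (X l)).
- exact: unit2.
- exact: unit_sqrtp.
- exact: unit_gen.
- exact: sqrtp_sq_central.
- by rewrite genM_sqrtp eqxx expr1 mulN1r.
- move=> _ [[i _ <-]|[i _ <-]]; first by exists (i == l); rewrite genM_sqrtp.
  by exists false; rewrite mul1r; apply: sqrtp_comm.
- apply/centralizerP => _ [[i _ <-]|[i /= il <-]]; first exact: gen_comm.
  by rewrite /GRing.comm genM_sqrtp gtn_eqF// mul1r.
- by left; exists l.
suff <- : gens_sqrts l.+1 = S l |` gens_sqrts l by [].
apply/seteqP; split=> [t [Xt|[i /= + <-]]|t [->|[Xt|[i /= il <-]]]].
- by right; left.
- by rewrite ltnS leq_eqVlt => /orP[/eqP->|il]; [left|right; right; exists i].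
- by right; exists l => /=.
- by left.
- by right; exists i => //=; apply: ltnW.
Qed.

(** With all roots gone, [X 0], [X 1], and so on are dropped in turn with the roles exchanged:
    [u = X k], [v = S k]. The bound on [k] puts [S k] in [gens_sqrts n]. *)
Lemma spanned_high_gens n k : (k <= n)%N ->
  spanned_centralizer (high_gens k) (gens_sqrts n).
Proof.
elim: k => [_|k IHk kn].
  suff <- : gens_sqrts 0 = high_gens 0 by apply: spanned_gens_sqrts.
  apply/seteqP; split=> [t [[i _ <-]|[i]]|t [i _ <-]] //; first by exists i.
  by left; exists i.
apply: (@spanned_centralizer_step _ _ _ (X k) (S k)).
- exact: unit2.
- exact: unit_gen.
- exact: unit_sqrtp.
- exact: gen_sq_central.
- by rewrite genM_sqrtp eqxx expr1 mulN1r opprK.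
- by move=> _ [i _ <-]; exists false; rewrite mul1r; apply: gen_comm.
- apply/centralizerP => _ [i /= ki <-].
  by apply/commr_sym; rewrite /GRing.comm genM_sqrtp gtn_eqF// mul1r.
- by right; exists k.
suff <- : high_gens k = X k |` high_gens k.+1 by apply: IHk; apply: ltnW.
apply/seteqP; split=> [t [i /= + <-]|t [->|[i /= ki <-]]].
- by rewrite leq_eqVlt => /orP[/eqP->|ki]; [left|right; exists i].
- by exists k => /=.
- by exists i => //=; apply: ltnW.
Qed.

Lemma centralizer_high_gens_centrally_finite n :
  centrally_finite (subdiv (centralizer (high_gens n))).
Proof.
apply: (centralizer_centrally_finite _ _ _ (spanned_high_gens (leqnn n))).
- exact: divD.
- by move=> t [i _ <-]; left; exists i.
- by move=> a b /centralizer_gens_fixed fa /centralizer_gens_fixed fb;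
    apply: fixed_coefs_comm => //.
Qed.

End SignAction.

(** * Local linearity and non-algebraicity of [Rinf] *)

Section Construction.
Variables (R : realType) (p : nat -> nat).
Hypothesis p_prime : forall i, prime (p i).
Hypothesis p_inj : injective p.
Local Notation K := (sqrt_field R p).
Local Notation Phi := (Phi R p).
Local Notation D := (series Phi).
Local Notation X i := (groupD R p (zgen i)).
Local Notation S i := (constD (sqrtp R p i)).

Let conjE : forall i, conj_spec i (conj_auto R p i) := conj_autoE R p_prime p_inj.

Lemma D_division : division_ring D.
Proof. by apply: series_division => c c0; exists c^-1; apply: divff. Qed.

Lemma sqrt_field_comm (c d : K) : GRing.comm c d.
Proof. exact: mulrC. Qed.

Lemma Phi_ratr x q : Phi x (ratr q) = ratr q.
Proof. exact: fmorph_rat. Qed.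

Lemma Phi_gen i c : Phi (zgen i) c = conj_auto R p i c.
Proof.
apply: (@sqrt_field_rmorphism_ext _ _ (Phi_map R p (zgen i)) (conj_auto R p i)).
move=> j; rewrite Phi_sqrtp zcoef_gen [RHS]conjE.
by case: (eqVneq j i) => [->|_] //=; rewrite conjE eqxx.
Qed.

Lemma Phi_gen_fixed c : (forall i, Phi (zgen i) c = c) -> forall x, Phi x c = c.
Proof.
move=> fc x; rewrite /= /Phi_fun.
apply: (big_ind (fun g : K -> K => g c = c)) => //=.
- by move=> f g fE gE; rewrite gE.
- by move=> i _; elim: `|_|%N => //= n ->; rewrite -Phi_gen.
Qed.

Lemma sqrtp_neq0 i : sqrtp R p i != 0.
Proof.
rewrite -(inj_eq val_inj) val_sqrtp /= sqrtr_eq0 -ltNge ltr0n.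
exact: prime_gt0.
Qed.

Lemma sqrtp_sq i : sqrtp R p i * sqrtp R p i = (p i)%:R.
Proof.
by apply: val_inj; rewrite (rmorphM \val) rmorph_nat /= -expr2 sqr_sqrtr ?ler0n.
Qed.

Lemma Phi_gen_sqrtp i j :
  Phi (zgen i) (sqrtp R p j) = (-1) ^+ (i == j) * sqrtp R p j.
Proof.
rewrite Phi_gen conjE eq_sym.
by case: (i == j); [rewrite expr1 mulN1r | rewrite expr0 mul1r].
Qed.

Lemma Phi_sqrtp_sq x i : Phi x (sqrtp R p i * sqrtp R p i) = sqrtp R p i * sqrtp R p i.
Proof. by rewrite sqrtp_sq; apply: rmorph_nat. Qed.

Lemma unit_S i : S i \is a GRing.unit.
Proof. exact: (unit_sqrtp D_division sqrtp_neq0). Qed.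

Lemma Phi_gen_involutive i c : Phi (zgen i) (Phi (zgen i) c) = c.
Proof. by rewrite !Phi_gen conj_autoK. Qed.

Lemma sqrt_field2_neq0 : (2 : K) != 0.
Proof. by rewrite -(inj_eq val_inj); apply/negbT; apply: (pnatr_eq0 R 2). Qed.

Lemma centralizer_high_gens_finite n :
  centrally_finite (subdiv (centralizer (@high_gens _ Phi n))).
Proof.
exact: (centralizer_high_gens_centrally_finite sqrt_field_comm D_division sqrt_field2_neq0 sqrtp_neq0
  Phi_sqrtp_sq Phi_gen_sqrtp Phi_gen_involutive Phi_gen_fixed).
Qed.

Lemma scoef_alpha x :
  scoef (alpha R p) x = if `[< exists i, x = - zgen i >] then 1 else 0.
Proof. by []. Qed.

(** For [n <= j], [X j] commutes with each generator: [alpha] and the series in [baseF] have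
    rational coefficients, and [X j] anticommutes with no root but [S j]. *)
Lemma Rn_high_gens n : {subset @Rn R p n <= centralizer (@high_gens _ Phi n)}.
Proof.
apply: divgen_ind; first exact: centralizer_closed.
move=> b gb; apply/centralizerP => _ [j /= nj <-].
case: gb => [[[[_ bQ]|[i /= ni <-]]|[i _ <-]]|->].
- by apply: fixed_comm_gen => y; have [q ->] := bQ y; apply: Phi_ratr.
- by apply/commr_sym; rewrite /GRing.comm (genM_sqrtp Phi_gen_sqrtp) gtn_eqF ?mul1r// (leq_trans ni).
- exact: gen_comm.
- apply: fixed_comm_gen => y; rewrite scoef_alpha.
  by case: ifP => _; rewrite ?rmorph1 ?rmorph0.
Qed.

Lemma Rinf_division : division_ring (Rinf R p).
Proof. by apply: subdiv_division; apply: D_division. Qed.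

Lemma Rinf_finite_Rn (A : set (Rinf R p)) : finite_set A ->
  exists n, forall x, A x -> \val x \in @Rn R p n.
Proof.
move=> /finite_seqP[s ->]; elim: s => [|x s [n IHn]]; first by exists 0%N.
have /asboolP[m _ xm] := valP x; exists (maxn m n) => y /=.
rewrite inE => /orP[/eqP->|ys]; first by apply: Rn_sub xm; apply: leq_maxl.
by apply: Rn_sub (IHn _ ys); apply: leq_maxr.
Qed.

Lemma Rinf_locally_linear : locally_linear (Rinf R p).
Proof.
move=> A /Rinf_finite_Rn[n An]; set L := subdiv (centralizer (@high_gens _ Phi n)).
exists L; split.
- exact/subdiv_division/D_division.
- exact: centralizer_high_gens_finite.
- by apply: divgen_embedding => x /An/Rn_high_gens.
Qed.

Lemma zgen_inj : injective zgen.
Proof.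
move=> i j /zseqP/(_ i); rewrite !zcoef_gen eqxx.
by case: eqP.
Qed.

(** The right factor is twisted by [Phi x], which negates the [j]-th root exactly when coordinate
    [j] of [x] is odd; on the support of [alpha] this means [x = - zgen j]. *)
Lemma scoef_conj_alpha j x : scoef (S j * alpha R p / S j) x =
  if x == - zgen j then -1 else scoef (alpha R p) x.
Proof.
have -> : (S j)^-1 = constD (sqrtp R p j)^-1.
  apply: (mulrI (unit_S j)); rewrite divrr ?unit_S//.
  by rewrite /constD monomialM zact0 addr0 divff ?sqrtp_neq0.
rewrite /constD scoef_mulmonomial scoef_monomialM zact0 !subr0 scoef_alpha fmorphV.
case: asboolP => [[i ->]|no]; last first.
  by rewrite mulr0 mul0r; case: eqP => // xE; case: no; exists j.
rewrite mulr1 [Phi _ _]Phi_sqrtp zcoefN zcoef_gen (inj_eq oppr_inj) (inj_eq zgen_inj) eq_sym.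
case: (eqVneq i j) => _ /=; last by rewrite divff ?sqrtp_neq0.
by rewrite conjE eqxx invrN mulrN divff ?sqrtp_neq0.
Qed.

Lemma conj_alpha_fixed j : fixed_coefs (S j * alpha R p / S j).
Proof.
move=> x y; rewrite scoef_conj_alpha scoef_alpha.
by case: ifP => _; [rewrite rmorphN1|case: ifP => _; rewrite ?rmorph1 ?rmorph0].
Qed.

(** For [i != j] the coefficients at [- zgen i] are -1 and 1, and their equality would give 2 = 0 in
    [R]. *)
Lemma conj_alpha_inj : injective (fun j => S j * alpha R p / S j).
Proof.
move=> i j /seriesP/(_ (- zgen i)); rewrite !scoef_conj_alpha eqxx.
rewrite (inj_eq oppr_inj) (inj_eq zgen_inj); case: eqVneq => // _.
rewrite scoef_alpha asboolT; last by exists i.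
move/eqP; rewrite eq_sym -subr_eq0 opprK -(inj_eq val_inj) => /eqP/= E.
by have := pnatr_eq0 R 2; rewrite -[2%:R]/(1 + 1) E eqxx.
Qed.

Lemma Rinf_gens (a : D) n : @Rgens R p n a -> a \in @Rinf_pred R p.
Proof.
(* [Rinf_pred] asks for a positive index; the successor also covers [n = 0]. *)
move=> ga; apply/asboolP; exists n.+1 => //; apply: (Rn_sub (leqnSn n)).
exact: sub_divgen.
Qed.

Lemma Rinf_not_algebraic : ~ algebraic_over_center (Rinf R p).
Proof.
have Sin j : S j \in @Rinf_pred R p.
  by apply: (@Rinf_gens _ j.+1); do 2 left; right; exists j => /=.
have Ain : alpha R p \in @Rinf_pred R p by apply: (@Rinf_gens _ 0); right.
pose s j : Rinf R p := Sub (S j) (Sin j).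
pose A : Rinf R p := Sub (alpha R p) Ain.
apply: (@infinite_conjugates_not_algebraic _ A s).
- exact: Rinf_division.
- exact: unit_S.
- move=> i j; apply: val_inj.
  exact: (fixed_coefs_comm sqrt_field_comm (conj_alpha_fixed i) (conj_alpha_fixed j)).
- by move=> i j /(congr1 \val)/conj_alpha_inj.
Qed.

End Construction.

Theorem proposition2p10 (R : realType) (p : nat -> nat)
    (p_prime : forall i, prime (p i))
    (p_incr : forall i j, (i < j)%N -> (p i < p j)%N) :
  locally_linear (Rinf R p) /\ ~ algebraic_over_center (Rinf R p).
Proof.
have p_inj : injective p.
  by move=> i j pij; case: (ltngtP i j) => // /p_incr; rewrite pij ltnn.
by split; [apply: Rinf_locally_linear | apply: Rinf_not_algebraic].
Qed.
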